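(* Let $a\in L^{N/2}(\mathbb{R}^N)$, $a\ge 0$, $a\ne 0$, $\lim_{|x|\to\infty}a(x)=0$, and let $b\in L^{\infty}(\mathbb{R}^N)$, $b\ge 0$, $b\ne 0$, $\lim_{|x|\to\infty}b(x)=0$. Let $\lambda\ge 0$ and set $m_\lambda=\inf\{I_\lambda(u): u\in\mathcal{N}_\lambda\}$. Then $$0<m_\lambda\le m_\infty .$$
   Context: $N\ge 2$ is an integer; $p>1$, and $p<\frac{N+2}{N-2}$ if $N\ge 3$; $a_\infty>0$ and $b_\infty>0$ are constants. On $H^1(\mathbb{R}^N)$, $$I_\lambda(u)=\frac12\int_{\mathbb{R}^N}|\nabla u|^2+(a_\infty+\lambda a(x))u^2-\frac1{p+1}\int_{\mathbb{R}^N}(b_\infty+b(x))|u|^{p+1},$$ $$I_\infty(u)=\frac12\int_{\mathbb{R}^N}|\nabla u|^2+a_\infty u^2-\frac1{p+1}\int_{\mathbb{R}^N}b_\infty|u|^{p+1},$$ $\mathcal{N}_\lambda=\{u\in H^1(\mathbb{R}^N)\setminus\{0\}: I_\lambda'(u)[u]=0\}$, $\mathcal{N}_\infty=\{u\in H^1(\mathbb{R}^N)\setminus\{0\}: I_\infty'(u)[u]=0\}$, and $m_\infty=\inf\{I_\infty(u):u\in\mathcal{N}_\infty\}$. *)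

(* Defs.v *)
From HB Require Import structures.
From mathcomp Require Import all_boot all_order all_algebra.
From mathcomp Require Import all_classical all_reals all_analysis.

Set Implicit Arguments.
Unset Strict Implicit.
Unset Printing Implicit Defensive.
Import Order.TTheory GRing.Theory Num.Theory.
Import numFieldNormedType.Exports.

Local Open Scope classical_set_scope.
Local Open Scope ring_scope.

(* The sigma-algebra on R^n is generated by the coordinate maps; it is the
   Borel sigma-algebra. *)
Definition measure_rV_display : measure_display.
Proof. exact. Qed.

Section measurable_rV.
Context {R : realType} (n : nat).

Definition rV_coord (i : 'I_n) (x : 'rV[R]_n) : measurableTypeR R := x ord0 i.

Let rV_set0 : g_sigma_preimage rV_coord set0.
Proof. exact: sigma_algebra0. Qed.

Let rV_setC A : g_sigma_preimage rV_coord A -> g_sigma_preimage rV_coord (~` A).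
Proof. exact: sigma_algebraC. Qed.

Let rV_bigcup (F : (set 'rV[R]_n)^nat) :
  (forall i, g_sigma_preimage rV_coord (F i)) ->
  g_sigma_preimage rV_coord (\bigcup_i (F i)).
Proof. exact: sigma_algebra_bigcup. Qed.

HB.instance Definition _ := @isMeasurable.Build measure_rV_display
  'rV[R]_n (g_sigma_preimage rV_coord) rV_set0 rV_setC rV_bigcup.

End measurable_rV.

Section measurable_rV_lemmas.
Context {R : realType}.

Lemma measurable_rV_coord n (i : 'I_n) :
  measurable_fun [set: 'rV[R]_n] (rV_coord i).
Proof.
move=> _ Y mY; rewrite setTI; apply: sub_sigma_algebra => /=.
rewrite -bigcup_seq/=; exists i => /=; first by rewrite mem_index_enum.
by exists Y => //; rewrite setTI.
Qed.

Lemma measurable_fun_rVP d (T : measurableType d) n (f : T -> 'rV[R]_n) :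
  (forall i, measurable_fun setT (rV_coord i \o f)) -> measurable_fun setT f.
Proof.
move=> mf _ A mA.
have : <<s preimage_set_system [set: T] f
      (\big[setU/set0]_(i < n)
        preimage_set_system setT (@rV_coord R n i) measurable) >>
    `<=` measurable.
  apply: smallest_sub; first exact: sigma_algebra_measurable.
  move=> _ [B + <-]; rewrite -bigcup_seq => -[i _ [C mC <-]].
  by rewrite setTI; exact: mf.
by apply; rewrite g_sigma_preimageE; exists A.
Qed.

Definition rV_cons n (z : measurableTypeR R * 'rV[R]_n) : 'rV[R]_n.+1 :=
  row_mx (z.1 : R)%:M z.2.

Lemma rV_cons0 n z : rV_coord ord0 (@rV_cons n z) = z.1.
Proof.
transitivity (@rV_cons n z ord0 (lshift n (ord0 : 'I_1))).
  by congr fun_of_matrix; exact: val_inj.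
by rewrite (@row_mxEl R 1 1 n) mxE eqxx mulr1n.
Qed.

Lemma rV_consS n z (i : 'I_n) :
  rV_coord (lift ord0 i) (rV_cons z) = rV_coord i z.2.
Proof.
transitivity (@rV_cons n z ord0 (rshift 1 i)).
  by congr fun_of_matrix; exact: val_inj.
by rewrite (@row_mxEr R 1 1 n).
Qed.

Lemma measurable_rV_cons n : measurable_fun setT (@rV_cons n).
Proof.
apply: measurable_fun_rVP => i; case: (unliftP ord0 i) => [j|] ->.
  rewrite (_ : _ \o _ = rV_coord j \o snd); last first.
    by apply/funext => z /=; rewrite rV_consS.
  by apply: measurableT_comp => //; exact: measurable_rV_coord.
rewrite (_ : _ \o _ = fst) //.
by apply/funext => z /=; rewrite rV_cons0.
Qed.

End measurable_rV_lemmas.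

Section lebesgue_rV.
Context {R : realType}.

Section step.
Variables (n : nat) (mu : {sigma_finite_measure set 'rV[R]_n -> \bar R}).

Definition rV_consm : set 'rV[R]_n.+1 -> \bar R :=
  pushforward (lebesgue_measure \x mu)%E (@rV_cons R n).

Let rV_consm0 : rV_consm set0 = 0%E.
Proof. by rewrite /rV_consm /pushforward preimage_set0 measure0. Qed.

Let rV_consm_ge0 A : (0 <= rV_consm A)%E.
Proof. by rewrite /rV_consm /pushforward measure_ge0. Qed.

Let rV_consm_sigma_additive : semi_sigma_additive rV_consm.
Proof.
have mc := @measurable_rV_cons R n.
exact: measure_semi_sigma_additive.
Qed.

HB.instance Definition _ := isMeasure.Build _ _ _ rV_consm
  rV_consm0 rV_consm_ge0 rV_consm_sigma_additive.

Let rV_consm_sigma_finite : sigma_finite setT rV_consm.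
Proof.
have [F FT mF] : sigma_finite setT (@lebesgue_measure R \x mu)%E.
  have /sigma_finiteP[F [TF ndF Foo]] := sigma_finiteT (@lebesgue_measure R).
  have /sigma_finiteP[G [TG ndG Goo]] := sigma_finiteT mu.
  exists (fun k => F k `*` G k).
    rewrite -setXTT TF TG predeqE => -[x y]; split.
      move=> [/= [k _ Fkx] [l _ Gly]]; exists (maxn k l) => //; split.
      - by move: x Fkx; exact/subsetPset/ndF/leq_maxl.
      - by move: y Gly; exact/subsetPset/ndG/leq_maxr.
    by move=> [k _ []/= ? ?]; split; exists k.
  move=> k; have [? ?] := Foo k; have [? ?] := Goo k.
  split; first exact: measurableX.
  by rewrite product_measure1E// lte_mul_pinfty// ge0_fin_numE.
pose g (x : 'rV[R]_n.+1) : measurableTypeR R * 'rV[R]_n :=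
  (rV_coord ord0 x, \row_i rV_coord (lift ord0 i) x).
have mg : measurable_fun setT g.
  apply: measurable_fun_pair; first exact: measurable_rV_coord.
  apply: measurable_fun_rVP => i.
  rewrite (_ : _ \o _ = rV_coord (lift ord0 i)); last first.
    by apply/funext => x /=; rewrite /rV_coord mxE.
  exact: measurable_rV_coord.
have consK : cancel (@rV_cons R n) g.
  move=> z; rewrite /g rV_cons0 [RHS]surjective_pairing; congr pair.
  by apply/rowP => i; rewrite mxE rV_consS.
exists (fun k => g @^-1` F k).
  by rewrite -preimage_bigcup -FT preimage_setT.
move=> k; have [mFk Fkoo] := mF k; split.
  by rewrite -[_ @^-1` _]setTI; exact: mg.
rewrite /rV_consm /pushforward -comp_preimage.
rewrite (_ : g \o _ = id) //; exact/funext.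
Qed.

HB.instance Definition _ :=
  Measure_isSigmaFinite.Build _ _ _ rV_consm rV_consm_sigma_finite.

End step.

Fixpoint lebesgue_rV n : {sigma_finite_measure set 'rV[R]_n -> \bar R} :=
  match n with
  | 0 => \d_(0 : 'rV[R]_0)
  | n'.+1 => rV_consm (lebesgue_rV n')
  end.

End lebesgue_rV.

Section sobolev.
Context {R : realType} (n : nat).
Notation E := 'rV[R]_n.
Notation mu := (@lebesgue_rV R n).
Implicit Types (u v g phi : E -> R).

Definition partial (i : 'I_n) phi : E -> R := fun x => 'D_(delta_mx 0 i) phi x.

Definition smooth phi : Prop := forall s : seq 'I_n,
  let psi := foldr partial phi s in
  continuous psi /\ forall i x, derivable psi x (delta_mx 0 i).

Definition test_function phi : Prop :=
  smooth phi /\ compact (closure [set x | phi x != 0]).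

Definition weak_partial (i : 'I_n) u g : Prop := forall phi, test_function phi ->
  \int[mu]_x (u x * partial i phi x) = - \int[mu]_x (g x * phi x).

(* H^1 is given by representatives: its elements as functions modulo almost
   everywhere equality are the classes of the elements of this set. *)
Definition H1 : set (E -> R) := [set u | u \in Lfun mu 2%:E /\
  forall i, exists2 g, g \in Lfun mu 2%:E & weak_partial i u g].

(* The i-th component of the weak gradient, determined up to a null set when
   u is in H1. *)
Definition wpartial (i : 'I_n) u : E -> R :=
  xget (cst 0) [set g | g \in Lfun mu 2%:E /\ weak_partial i u g].

(* The real-valued integral of a nonnegative function with infinite integral is
   0. For nonnegative V in L^(n/2) + L^oo and u in H1, the first integral can be
   infinite only if n = 2; the energy of u should then be +oo. Such a u is not in
   the Nehari set below if u and Q > 0 do not vanish: the derivative of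
   energy V Q p at u in the direction u is minus the second integral. *)
Definition energy (V Q : E -> R) (p : R) u : R :=
  2^-1 * \int[mu]_x (\sum_i wpartial i u x ^+ 2 + V x * u x ^+ 2)
  - (p + 1)^-1 * \int[mu]_x (Q x * `|u x| `^ (p + 1)).

(* l is the value I'(u)[v] of the derivative of I at u in the direction v. *)
Definition is_variation (I : (E -> R) -> R) u v (l : R) : Prop :=
  is_derive (0 : R) (1 : R) (fun t : R => I (fun x => u x + t * v x)) l.

Definition nehari (I : (E -> R) -> R) : set (E -> R) := [set u |
  [/\ H1 u, ~ (u = cst 0 %[ae mu]) & is_variation I u u 0]].

(* The infimum of the library is 0 on a set that is empty or not bounded below;
   in particular 0 < nehari_level I entails that neither is the case. *)
Definition nehari_level (I : (E -> R) -> R) : R := inf (I @` nehari I).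

Definition I_lambda (ainf binf p lambda : R) (a b : E -> R) : (E -> R) -> R :=
  energy (fun x => ainf + lambda * a x) (fun x => binf + b x) p.

Definition I_infty (ainf binf p : R) : (E -> R) -> R :=
  energy (cst ainf) (cst binf) p.

(* Limit at infinity of an element of an L^q space, hence up to a null set. *)
Definition ae_lim_infty u (l : R) : Prop := forall e : R, 0 < e ->
  exists r : R, {ae mu, forall x, r < `|x| -> `|u x - l| < e}.

End sobolev.

(* Main.v *)
Require Import Defs.
From HB Require Import structures.
From mathcomp Require Import all_boot all_order all_algebra.
From mathcomp Require Import all_classical all_reals all_analysis.
From mathcomp Require Import measurable_realfun ess_sup_inf.
From mathcomp Require Import ring lra.

Set Implicit Arguments.
Unset Strict Implicit.
Unset Printing Implicit Defensive.
Import Order.TTheory GRing.Theory Num.Theory.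
Import numFieldNormedType.Exports.

Local Open Scope classical_set_scope.
Local Open Scope ring_scope.

(* Write A(u) for the quadratic part of 2 I and B(u) for the integral of
   Q |u|^(p+1). Then u <> 0 is in the Nehari set iff A(u) = B(u), where
   I(u) = (1/2 - 1/(p+1)) A(u), and every u <> 0 with A(u) finite has a multiple
   in the Nehari set of energy (1/2 - 1/(p+1)) (A(u)/B(u))^(2/(p-1)) A(u).
   Positivity: the subcritical Sobolev inequality gives B(u) <= C A(u)^((p+1)/2),
   so A is bounded away from 0 on the Nehari set.
   Comparison: given u in the Nehari set at infinity, averaging the integral of
   a(x) u(x+y)^2 over y in a large cube shows that it is arbitrarily small for
   some y, because a is a small function plus an integrable one. Hence the
   translate v of u satisfies A_lambda(v) <= s A_infty(u) with s as close to 1 as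
   desired, while B_lambda(v) >= B_infty(u) since b >= 0, and projecting v on the
   Nehari set of I_lambda gives m_lambda <= s^(1 + 2/(p-1)) I_infty(u). *)

(** * Lebesgue measure on R^n *)

(** The Sobolev inequality is derived from [weak_partial] directly, by way of translations. Testing
    [u(x + s e_i) - u(x)] against bumps and using Fubini bounds its squared L^2 norm by [s^2] times
    that of the weak derivative. Averaging over small cubes turns this L^2 modulus of continuity
    into integrability of any order below [2 + 2 q / n], once order [q] is known; iteration reaches
    every subcritical exponent. The obstacle in the first step is that L^2 functions are integrable
    only locally, so the fundamental lemma is used in a form localized to a cube. Two conventions
    shape the rest. A real-valued integral is 0 where the extended one is infinite, so finiteness of
    the quadratic part is always a separate question: on the Nehari set it follows from [A = B > 0],
    and for the translate [v] from the very estimate that makes the integral of [a v^2] small. An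
    infimum over the empty set is 0, so both Nehari sets must be inhabited; this is why bumps are
    shown to lie in H^1. *)

Section lebesgue_rV_theory.
Context {R : realType}.
Implicit Types n : nat.

Lemma lebesgue_measure_shift (t : R) (A : set (measurableTypeR R)) :
  measurable A ->
  lebesgue_measure ((fun x : R => x + t) @^-1` A) = lebesgue_measure A.
Proof.
move=> mA.
have mt : measurable_fun setT ((fun x : R => x + t) : measurableTypeR R -> measurableTypeR R).
  exact: measurable_funD.
transitivity (pushforward lebesgue_measure
   ((fun x : R => x + t) : measurableTypeR R -> measurableTypeR R) A) => //.
apply/esym/(@lebesgue_measure_unique R) => //= _ [[a b]] _ <-.
rewrite /pushforward (_ : _ @^-1` _ = `]a - t, b - t]%classic); last first.
  by apply/seteqP; split => x /=; rewrite !in_itv/= ltrBlDr lerBrDr.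
rewrite !lebesgue_measure_itv/= !lte_fin ltrD2r; case: ifPn => // _.
by rewrite -!EFinD opprD opprK addrACA addNr addr0.
Qed.

Lemma measurable_shift n (y : 'rV[R]_n) :
  measurable_fun setT (fun x : 'rV[R]_n => x + y).
Proof.
apply: measurable_fun_rVP => i.
rewrite (_ : _ \o _ = fun x => rV_coord i x + y ord0 i); last first.
  by apply/funext => x /=; rewrite /rV_coord mxE.
by apply: measurable_funD => //; exact: measurable_rV_coord.
Qed.

Lemma measurable_addrV n :
  measurable_fun setT (fun z : 'rV[R]_n * 'rV[R]_n => z.1 + z.2).
Proof.
apply: measurable_fun_rVP => i.
rewrite (_ : _ \o _ = fun z => rV_coord i z.1 + rV_coord i z.2); last first.
  by apply/funext => x /=; rewrite /rV_coord mxE.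
by apply: measurable_funD => //; apply: measurableT_comp => //; exact: measurable_rV_coord.
Qed.

Lemma measurable_add_scale n (v : 'rV[R]_n) :
  measurable_fun setT (fun z : 'rV[R]_n * measurableTypeR R => z.1 + (z.2 : R) *: v).
Proof.
apply: measurable_fun_rVP => i.
rewrite (_ : _ \o _ = fun z => rV_coord i z.1 + z.2 * v ord0 i); last first.
  by apply/funext => x /=; rewrite /rV_coord !mxE.
apply: measurable_funD => //; first by apply: measurableT_comp => //; exact: measurable_rV_coord.
exact: measurable_funM.
Qed.

(** Through [rV_cons] a translation becomes a product of a translation of the line and one of [R^n],
    so the image of the product measure agrees with it on rectangles, by induction on the
    dimension. *)
Lemma lebesgue_rV_shift n (y : 'rV[R]_n) (A : set 'rV[R]_n) : measurable A ->
  lebesgue_rV n ((fun x => x + y) @^-1` A) = lebesgue_rV n A.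
Proof.
elim: n y A => [|n IH] y A mA /=.
  rewrite /dirac/= !indicE; congr ((_ : bool)%:R%:E).
  by apply/idP/idP; rewrite !inE /= (_ : 0 + y = 0)//; apply/rowP => -[].
rewrite /rV_consm /pushforward -comp_preimage.
pose y' := \row_i y ord0 (lift ord0 i).
pose s (z : measurableTypeR R * 'rV[R]_n) : measurableTypeR R * 'rV[R]_n :=
  (z.1 + y ord0 ord0, z.2 + y').
have -> : (fun x => x + y) \o rV_cons (n:=n) = rV_cons (n:=n) \o s.
  apply/funext => z /=; apply/rowP => i; rewrite mxE.
  case: (unliftP ord0 i) => [j|] ->.
    by have := @rV_consS R n z j; have := rV_consS (s z) j; rewrite /rV_coord/= => -> ->;
      rewrite !mxE.
  by have := @rV_cons0 R n z; have := rV_cons0 (s z); rewrite /rV_coord/= => -> ->.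
have ms : measurable_fun setT s.
  apply: measurable_fun_pair.
    by apply: measurable_funD.
  by apply: (measurableT_comp (measurable_shift y')).
rewrite comp_preimage.
have mc := measurable_rV_cons (R:=R) (n:=n).
have mB : measurable (rV_cons (R:=R) (n:=n) @^-1` A).
  by rewrite -[X in measurable X]setTI; exact: mc.
transitivity (pushforward (lebesgue_measure \x lebesgue_rV n)%E s (rV_cons (R:=R) (n:=n) @^-1` A)) => //.
apply/esym.
apply: (@product_measure_unique _ _ _ _ _ lebesgue_measure (lebesgue_rV n)
  (pushforward (lebesgue_measure \x lebesgue_rV n)%E s)) => //= B C mB' mC.
rewrite /pushforward (_ : s @^-1` _ = ((fun x : R => x + y ord0 ord0) @^-1` B) `*` ((fun x => x + y') @^-1` C)) //.
rewrite product_measure1E//.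
- by congr (_ * _)%E; [exact: lebesgue_measure_shift|exact: IH].
- rewrite -[X in measurable X]setTI.
  by apply: (measurable_funD (D:=setT) (f := fun x : measurableTypeR R => x : R) (g := cst _)).
- by rewrite -[X in measurable X]setTI; exact: measurable_shift.
Qed.

Lemma ge0_integral_shift n (y : 'rV[R]_n) (f : 'rV[R]_n -> \bar R) :
  measurable_fun setT f -> (forall x, 0 <= f x)%E ->
  (\int[lebesgue_rV n]_x f (x + y)%R = \int[lebesgue_rV n]_x f x)%E.
Proof.
move=> mf f0.
transitivity (\int[pushforward (lebesgue_rV n) (fun x => x + y)%R]_x f x)%E.
  by rewrite ge0_integral_pushforward//; exact: measurable_shift.
apply: eq_measure_integral => [|? A mA _]; first exact: measurable_shift.
exact: lebesgue_rV_shift.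
Qed.

Lemma integral_shift n (y : 'rV[R]_n) (f : 'rV[R]_n -> \bar R) :
  measurable_fun setT f ->
  (\int[lebesgue_rV n]_x f (x + y)%R = \int[lebesgue_rV n]_x f x)%E.
Proof.
move=> mf; rewrite [LHS]integralE [RHS]integralE.
congr (_ - _)%E.
  rewrite -(ge0_integral_shift y (measurable_funepos mf) (funepos_ge0 f)).
  by apply: eq_integral => x _; rewrite !funeposE.
rewrite -(ge0_integral_shift y (measurable_funeneg mf) (funeneg_ge0 f)).
by apply: eq_integral => x _; rewrite !funenegE.
Qed.

Lemma Rintegral_shift n (y : 'rV[R]_n) (f : 'rV[R]_n -> R) :
  measurable_fun setT f ->
  \int[lebesgue_rV n]_x f (x + y) = \int[lebesgue_rV n]_x f x.
Proof.
move=> mf; rewrite /Rintegral.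
by rewrite (integral_shift y (f := EFin \o f))//; exact/measurable_EFinP.
Qed.

Lemma integrable_shift n (y : 'rV[R]_n) (f : 'rV[R]_n -> \bar R) :
  (lebesgue_rV n).-integrable setT f ->
  (lebesgue_rV n).-integrable setT (fun x => f (x + y)).
Proof.
move=> /integrableP[mf fi]; apply/integrableP; split.
  exact: (measurableT_comp mf (measurable_shift y)).
rewrite (ge0_integral_shift y (f := abse \o f))//.
exact: measurableT_comp.
by move=> x /=; exact: abse_ge0.
Qed.

(** Open boxes play three roles: a generating family stable under intersection, an exhaustion of the
    space by cubes, and the sets off which the bumps vanish. *)
Definition obox n (a b : 'rV[R]_n) : set 'rV[R]_n :=
  [set x | forall i, a ord0 i < x ord0 i < b ord0 i].

Lemma measurable_obox n (a b : 'rV[R]_n) : measurable (obox a b).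
Proof.
rewrite (_ : obox a b = \bigcap_(i in [set: 'I_n])
   (rV_coord i @^-1` `]a ord0 i, b ord0 i[%classic)).
  apply: fin_bigcap_measurable => // i _.
  rewrite -[X in measurable X]setTI; apply: measurable_rV_coord => //.
apply/seteqP; split => x /= xab i.
  by move=> _ /=; rewrite in_itv; exact: xab.
by have := xab i I; rewrite /= in_itv.
Qed.

Lemma lebesgue_rV_obox n (a b : 'rV[R]_n) : (forall i, a ord0 i <= b ord0 i) ->
  lebesgue_rV n (obox a b) = (\prod_i (b ord0 i - a ord0 i))%:E.
Proof.
elim: n a b => [|n IH] a b ab /=.
  rewrite big_ord0 /dirac/= indicE mem_set// => -[]//.
rewrite /rV_consm /pushforward.
pose tl (x : 'rV[R]_n.+1) := \row_i x ord0 (lift ord0 i).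
have -> : rV_cons (n:=n) @^-1` obox a b =
   `]a ord0 ord0, b ord0 ord0[%classic `*` obox (tl a) (tl b).
  apply/seteqP; split => z.
    move=> zab; split.
      by have := zab ord0; have := rV_cons0 z; rewrite /rV_coord/= in_itv => ->.
    move=> i; have := zab (lift ord0 i); have := rV_consS z i; rewrite /rV_coord/= => ->.
    by rewrite !mxE.
  move=> [z1 z2] i; case: (unliftP ord0 i) => [j|] ->.
    have := rV_consS z j; rewrite /rV_coord/= => ->.
    by have := z2 j; rewrite !mxE.
  by have := rV_cons0 z; rewrite /rV_coord/= => ->; move: z1; rewrite /= in_itv.
rewrite product_measure1E//; last exact: measurable_obox.
rewrite IH; last by move=> i; rewrite !mxE.
rewrite big_ord_recl EFinM.
congr (_ * _)%E; last by congr (_%:E); apply: eq_bigr => i _; rewrite !mxE.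
apply: (etrans (lebesgue_measure_itv _)).
rewrite /= lte_fin; case: ifPn => //; rewrite -leNgt => ba.
have -> : b ord0 ord0 = a ord0 ord0 by apply/eqP; rewrite eq_le ba ab.
by rewrite subrr.
Qed.

Lemma lebesgue_rV_obox_lty n (a b : 'rV[R]_n) : (lebesgue_rV n (obox a b) < +oo)%E.
Proof.
have [ab|/existsNP[i /negP]] := pselect (forall i, a ord0 i <= b ord0 i).
  by rewrite lebesgue_rV_obox// ltry.
rewrite -ltNge => ba; rewrite (_ : obox a b = set0) ?measure0//.
apply/seteqP; split => // x /(_ i) /andP[/lt_trans h /h]; by rewrite ltNge ltW.
Qed.

Lemma ler_coord_norm n (x : 'rV[R]_n) i : `|x ord0 i| <= `|x|.
Proof.
rewrite [leRHS]/Num.norm/= mx_normrE; apply/bigmax_geP; right => /=.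
by exists (ord0, i).
Qed.

Lemma obox_bigcup n : \bigcup_k obox (const_mx (- k%:R)) (const_mx k%:R) = [set: 'rV[R]_n].
Proof.
apply/seteqP; split => // x _.
have [k xk] : exists k : nat, `|x| < k%:R.
  by exists (Num.truncn `|x|).+1; exact: truncnS_gt.
exists k => // i; rewrite !mxE -ltr_norml.
exact: le_lt_trans (ler_coord_norm x i) xk.
Qed.

Lemma setI_obox n (a b c d : 'rV[R]_n) :
  obox a b `&` obox c d = obox (\row_i Num.max (a ord0 i) (c ord0 i))
                               (\row_i Num.min (b ord0 i) (d ord0 i)).
Proof.
apply/seteqP; split => x /=.
  by move=> [h1 h2] i; rewrite !mxE gt_max lt_min; have /andP[-> ->] := h1 i; have /andP[-> ->] := h2 i.
by move=> h; split => i; have := h i; rewrite !mxE gt_max lt_min => /andP[/andP[h1 h2] /andP[h3 h4]]; apply/andP; split.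
Qed.

(** It suffices that every coordinate map is measurable for the sigma-algebra of boxes. The preimage
    of a ray []a, +oo[] is a countable union of boxes whose i-th lower bound is [a], all other
    bounds going to infinity. *)
Lemma measurable_rV_obox n :
  @measurable _ 'rV[R]_n `<=` <<s [set A | exists a b, A = obox a b] >>.
Proof.
apply: smallest_sub; first exact: smallest_sigma_algebra.
move=> A; rewrite /= -bigcup_seq => -[i _ [B mB <-]].
rewrite setTI.
pose G := [set A | exists a b : 'rV[R]_n, A = obox a b].
have : measurable_fun [set: g_sigma_algebraType G] (rV_coord i : g_sigma_algebraType G -> R).
  apply: (measurability _ (RGenOInfty.measurableE R)) => //.
  move=> /= _ [_ [a ->] <-]; rewrite setTI.
  have -> : rV_coord i @^-1` `]a, +oo[ =
     \bigcup_k obox (\row_j if j == i then a else - k%:R) (const_mx k%:R).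
    apply/seteqP; split => [x /= xa|x [k _]].
      rewrite in_itv/= andbT in xa.
      have : [set: 'rV[R]_n] x by [].
      rewrite -obox_bigcup => -[k _ xk]; exists k => // j; rewrite !mxE.
      by have := xk j; rewrite !mxE => /andP[h ->]; rewrite andbT; case: eqP => [->|].
    by move=> /(_ i); rewrite !mxE eqxx => /andP[? _]; rewrite /= in_itv/= andbT.
  apply: bigcupT_measurable => k; apply: sub_sigma_algebra; by exists (\row_j if j == i then a else - k%:R), (const_mx k%:R).
move=> /(_ (@measurableT _ (g_sigma_algebraType G)) B mB); by rewrite setTI.
Qed.

Lemma open_rV_obox n (U : set 'rV[R]_n) (x : 'rV[R]_n) : open U -> U x ->
  exists a b : 'rV[rat]_n, obox (map_mx ratr a) (map_mx ratr b) x /\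
    obox (map_mx ratr a) (map_mx ratr b) `<=` U.
Proof.
move=> oU Ux; have /nbhs_ballP[e /= e0 eU] : nbhs x U by exact: open_nbhs_nbhs.
have /choice[a xa] : forall i, exists q : rat, x ord0 i - e < ratr q < x ord0 i.
  move=> i; have /rat_in_itvoo[q] : x ord0 i - e < x ord0 i by rewrite ltrBlDr ltrDl.
  by rewrite in_itv/= => h; exists q.
have /choice[b xb] : forall i, exists q : rat, x ord0 i < ratr q < x ord0 i + e.
  move=> i; have /rat_in_itvoo[q] : x ord0 i < x ord0 i + e by rewrite ltrDl.
  by rewrite in_itv/= => h; exists q.
exists (\row_i a i), (\row_i b i); split.
  by move=> i; rewrite !mxE; move: (xa i) (xb i) => /andP[_ ->] /andP[->].
move=> y aby; apply: eU; split => // i j; rewrite !ord1 /ball/=.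
have := aby j; rewrite !mxE => /andP[ay yb].
have /andP[xa1 _] := xa j; have /andP[_ xb1] := xb j.
by rewrite ltr_norml; apply/andP; split; lra.
Qed.

(** Links the norm topology to the sigma-algebra of coordinates: an open set is the union of the
    rational boxes it contains, and these are enumerated by [unpickle]. *)
Lemma open_measurable_rV n (U : set 'rV[R]_n) : open U -> measurable U.
Proof.
move=> oU.
pose B (q : 'rV[rat]_n * 'rV[rat]_n) : set 'rV[R]_n :=
  obox (map_mx ratr q.1) (map_mx ratr q.2).
pose F k := if unpickle k is Some q then
  if `[<B q `<=` U>] then B q else set0 else set0.
have -> : U = \bigcup_k F k.
  apply/seteqP; split => x.
    move=> Ux; have [a [b [xab abU]]] := open_rV_obox oU Ux.
    by exists (pickle (a, b)) => //; rewrite /F pickleK asboolT.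
  by move=> [k _]; rewrite /F; case: unpickle => // q; case: asboolP => [BU /BU|].
apply: bigcupT_measurable => k; rewrite /F; case: unpickle => // q.
by case: ifP => // _; exact: measurable_obox.
Qed.

Lemma continuous_measurable_rV n (f : 'rV[R]_n -> R) :
  continuous f -> measurable_fun setT f.
Proof.
move=> cf; apply: (measurability _ (RGenOInfty.measurableE R)) => //.
move=> /= _ [_ [a ->] <-]; rewrite setTI; apply: open_measurable_rV.
by apply: open_comp => // x _; exact: cf.
Qed.

End lebesgue_rV_theory.

(** * Test functions *)

Section flat_function.
Context {R : realType}.
Implicit Types (P : {poly R}) (t : R).

(* The functions [P(1/t) exp(-1/t)] are closed under differentiation, which makes
   the smoothness of the bumps below a structural induction. *)
Definition flat P t : R := if 0 < t then P.[t^-1] * expR (- t^-1) else 0.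

Lemma expR_monomial_le k (s : R) : 0 < s -> s ^+ k * expR (- s) <= k.+1`!%:R.
Proof.
move=> s0; rewrite expRN ler_pdivrMr ?expR_gt0//.
case: k => [|k].
  rewrite expr0 mul1r; apply: (le_trans _ (expR_ge1Dx s)); lra.
apply: (@le_trans _ _ (k.+1`!%:R * expR s)); last first.
  by rewrite ler_wpM2r ?expR_ge0// ler_nat [leqRHS]factS leq_pmull.
rewrite mulrC -ler_pdivrMr ?ltr0n ?fact_gt0//.
by apply: le_trans (expR_ge1Dxn k (ltW s0)); rewrite lerDr.
Qed.

(** Yields the derivative 0 at the origin, the only point where the usual rules do not apply. With
    [s = t^-1], the monomial of degree [i] contributes [s^(i+2) exp(-s)], which [expR_monomial_le]
    bounds by a factorial. *)
Lemma flat_quad P : exists2 C : R, 0 <= C & forall t, `|flat P t| <= C * t ^+ 2.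
Proof.
exists (\sum_(i < size P) `|P`_i| * i.+3`!%:R).
  by apply: sumr_ge0 => i _; rewrite mulr_ge0.
move=> t; rewrite /flat; case: ifPn => [t0|_]; last first.
  by rewrite normr0 mulr_ge0 ?sqr_ge0// sumr_ge0// => i _; rewrite mulr_ge0.
rewrite normrM (ger0_norm (expR_ge0 _)) -ler_pdivrMr ?exprn_gt0//.
rewrite -exprVn; set s := t^-1; have s0 : 0 < s by rewrite invr_gt0.
rewrite horner_coef.
apply: (@le_trans _ _ (\sum_(i < size P) `|P`_i| * s ^+ i * expR (- s) * s ^+ 2)).
  rewrite -2!mulr_suml ler_wpM2r ?sqr_ge0// ler_wpM2r ?expR_ge0//.
  apply: le_trans (ler_norm_sum _ _ _) _; apply: ler_sum => i _.
  by rewrite normrM normrX (gtr0_norm s0).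
apply: ler_sum => i _; rewrite -!mulrA ler_wpM2l//.
rewrite (mulrC (expR _)) mulrA -exprD addn2.
exact: expR_monomial_le.
Qed.

(** For [t > 0] the derivative of [P(1/t) exp(-1/t)] is [t^-2 (P - P')(1/t) exp(-1/t)], and the
    factor [t^-2] is absorbed into the polynomial as [X^2]. At 0 the difference quotient is at most
    [C |t|]. *)
Lemma is_derive_flat P t :
  is_derive t (1 : R) (flat P) (flat ('X^2 * (P - P^`())) t).
Proof.
have [t0|t0|->] := ltgtP t 0.
- have -> : flat ('X^2 * (P - P^`())) t = 0 by rewrite /flat ltNge (ltW t0).
  apply: (@near_eq_is_derive R R R (cst 0)).
  near=> x; rewrite /flat; case: ifPn => // x0.
  suff : x < 0 by move/lt_trans => /(_ _ x0); rewrite ltxx.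
  by near: x; exact: lt_nbhsl.
- rewrite [in X in is_derive _ _ _ X]/flat t0.
  have tn0 : t != 0 by rewrite gt_eqF.
  have d1 : is_derive t (1 : R) (GRing.inv : R -> R) (- t ^- 2 *: 1).
    exact: is_deriveV.
  have dg : is_derive t (1 : R) (((horner P) \o GRing.inv) * (expR \o (-%R \o GRing.inv)))
     (('X^2 * (P - P^`())).[t^-1] * expR (- t^-1)).
    apply: is_derive_eq.
    rewrite !hornerE /= exprVn.
    set p := P.[_]; set q := _.[_]; set e := expR _.
    by rewrite /GRing.scale /=; ring.
  apply: near_eq_is_derive dg.
  near=> x; rewrite /flat ifT//; near: x; exact: lt_nbhsr.
- have f0 Q : flat Q 0 = 0 by rewrite /flat ltxx.
  rewrite f0; have [C C0 HC] := flat_quad P.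
  have h : (fun h : R => h^-1 *: ((flat P \o shift 0) (h *: (1 : R)) - flat P 0)) @ 0^' --> (0 : R).
    apply/cvgrPdist_le => e e0; near=> x.
    have x0 : x != 0 by near: x; exact: nbhs_dnbhs_neq.
    rewrite sub0r normrN f0 subr0 /= addr0 [x *: _]mulr1.
    rewrite [_ *: _]mulrC normrM normfV ler_pdivrMr ?normr_gt0//.
    apply: le_trans (HC x) _; rewrite -real_normK ?num_real// expr2 mulrA.
    rewrite ler_wpM2r//; near: x.
    have : (fun x : R => C * `|x|) @ 0^' --> (C * `|(0 : R)|).
      apply: cvg_within_filter; apply: cvgM; first exact: cvg_cst.
      exact: cvg_norm.
    rewrite normr0 mulr0 => /cvgrPdist_le /(_ e e0); apply: filterS => y.
    by rewrite sub0r normrN normrM normr_id (ger0_norm C0).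
  by apply: DeriveDef; [apply/cvg_ex; exists 0|exact: cvg_lim].
Unshelve. all: by end_near. Qed.

End flat_function.

Section smooth_class.
Context {R : realType} (n : nat).
Notation E := 'rV[R]_n.

Inductive flat_alg : (E -> R) -> Prop :=
| flat_alg_cst c : flat_alg (fun=> c)
| flat_alg_flat P c d j : flat_alg (fun x => flat P (c * x ord0 j + d))
| flat_algD f g : flat_alg f -> flat_alg g -> flat_alg (fun x => f x + g x)
| flat_algM f g : flat_alg f -> flat_alg g -> flat_alg (fun x => f x * g x).

Lemma is_diff_affine_coord (c d : R) (j : 'I_n) (x : E) :
  is_diff x (fun x : E => c * x ord0 j + d) (fun v => c * v ord0 j).
Proof.
have lc : linear (fun v : E => c * v ord0 j).
  by move=> k u v; rewrite !mxE mulrDr mulrCA.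
pose L : {linear E -> R} := HB.pack (fun v : E => c * v ord0 j)
  (GRing.isLinear.Build R E R *:%R _ lc).
have cL : continuous L.
  move=> z; apply: (@cvgM _ _ (nbhs z) _ (cst c) (fun v : E => v ord0 j) c (z ord0 j)).
    exact: cvg_cst.
  exact: coord_continuous.
have dL : is_diff x L L.
  by split; [exact: linear_differentiable|exact: diff_lin].
have := is_diffD dL (is_diff_cst d x).
by rewrite addr0.
Qed.

Lemma is_diff_flat P t : is_diff t (flat P : R -> R) (fun h : R => h * flat ('X^2 * (P - P^`())) t).
Proof.
have [d1 d2] := is_derive_flat P t.
have df : differentiable (flat P : R -> R) t by exact/derivable1_diffP.
split => //; rewrite diff1E// derive1E d2; exact/funext.
Qed.

Lemma is_diff_flat_coord P (c d : R) (j : 'I_n) (x : E) :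
  is_diff x (fun x : E => flat P (c * x ord0 j + d))
   (fun v => c * v ord0 j * flat ('X^2 * (P - P^`())) (c * x ord0 j + d)).
Proof.
exact: (@is_diff_comp _ _ _ _ _ _ _ _ _ (is_diff_affine_coord c d j x) (is_diff_flat P _)).
Qed.

Lemma flat_alg_differentiable f : flat_alg f -> forall x, differentiable f x.
Proof.
elim=> {f} [c x|P c d j x|f g _ df _ dg x|f g _ df _ dg x].
- exact: differentiable_cst.
- by have [] := is_diff_flat_coord P c d j x.
- exact: differentiableD.
- exact: differentiableM.
Qed.

Lemma flat_alg_partial i f : flat_alg f -> flat_alg (partial i f).
Proof.
elim=> {f} [c|P c d j|f g sf pf sg pg|f g sf pf sg pg].
- rewrite (_ : partial i _ = fun=> 0); first exact: flat_alg_cst.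
  by apply/funext => x; exact: derive_cst.
- rewrite (_ : partial i _ = fun x => (c * (i == j)%:R) * flat ('X^2 * (P - P^`())) (c * x ord0 j + d)).
    apply: (@flat_algM (fun=> _)); first exact: flat_alg_cst.
    exact: flat_alg_flat.
  apply/funext => x; have [d1 d2] := is_diff_flat_coord P c d j x.
  by rewrite /partial deriveE// d2 mxE eqxx/= (eq_sym j).
- rewrite (_ : partial i _ = fun x => partial i f x + partial i g x); first exact: flat_algD.
  apply/funext => x; apply: deriveD; apply: diff_derivable; exact: flat_alg_differentiable.
- rewrite (_ : partial i _ = fun x => f x * partial i g x + g x * partial i f x).
    by apply: flat_algD; exact: flat_algM.
  apply/funext => x; apply: deriveM; apply: diff_derivable; exact: flat_alg_differentiable.
Qed.

Lemma flat_alg_smooth f : flat_alg f -> smooth f.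
Proof.
move=> sf s /=.
have {sf} : flat_alg (foldr (partial (n:=n)) f s).
  by elim: s => //= i s; exact: flat_alg_partial.
move=> sf; split=> [x|i x].
  by apply: differentiable_continuous; exact: flat_alg_differentiable.
by apply: diff_derivable; exact: flat_alg_differentiable.
Qed.

Lemma compact_closure_supp (f : E -> R) : compact (closure [set x | f x != 0]) <->
  exists M : R, forall x, f x != 0 -> `|x| <= M.
Proof.
split.
  move/compact_bounded => [M [_ HM]]; exists (M + 1) => x fx.
  apply: (HM (M + 1)); first by rewrite ltrDl.
  exact: subset_closure.
move=> [M HM]; apply: bounded_closed_compact; last exact: closed_closure.
exists M; split; first exact: num_real.
move=> K MK x; have -> : [set x | f x != 0] = [set x | f x != 0] `&` [set x | `|x| <= M].
  by apply/seteqP; split => [y fy|y []//]; split => //; exact: HM.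
move=> /closureI[_].
have : closed [set x : E | `|x| <= M].
  apply: (@closed_comp _ _ (fun x : E => `|x|) [set y : R | y <= M]).
    by move=> y _; exact: norm_continuous.
  exact: closed_le.
move/closure_id => <- /= xM; apply: le_trans xM _; exact: ltW.
Qed.

Lemma partial_shift i (f : E -> R) y :
  partial i (fun x => f (x + y)) = fun x => partial i f (x + y).
Proof.
apply/funext => x; rewrite /partial /derive.
set g1 := fun h => h^-1 *: _; set g2 := fun h => h^-1 *: _.
suff -> : g1 = g2 by [].
by apply/funext => h; rewrite /g1 /g2 /= addrA.
Qed.

Lemma test_function_shift (f : E -> R) y :
  test_function f -> test_function (fun x => f (x + y)).
Proof.
move=> [sf /compact_closure_supp[M HM]]; split; last first.
  apply/compact_closure_supp; exists (M + `|y|) => x /HM.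
  move=> xyM; rewrite -[x](addrK y).
  by apply: le_trans (ler_normB _ _) _; rewrite lerD2r.
move=> s /=; have -> : foldr (partial (n:=n)) (fun x => f (x + y)) s =
   fun x => foldr (partial (n:=n)) f s (x + y).
  by elim: s => //= i s ->; rewrite partial_shift.
have [cf df] := sf s; split=> [x|i x].
  have cs : (fun x0 : E => x0 + y) @ x --> x + y by exact: (cvgD (@cvg_id _ (nbhs x)) (cvg_cst y)).
  exact: (cvg_comp _ _ cs (cf (x + y))).
have := df i (x + y); rewrite /derivable.
set g1 := fun h => h^-1 *: _; set g2 := fun h => h^-1 *: _.
suff -> : g1 = g2 by [].
by apply/funext => h; rewrite /g1 /g2 /= addrA.
Qed.

(** Positive on the open box when [k > 0] and zero off it. Dilating the one-dimensional profiles by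
    [k] makes each of them tend to 1 inside, so that the bumps tend to the indicator of the box
    while never leaving it. *)
Definition obump (k : nat) (a b : E) (x : E) : R :=
  \prod_(j < n) (flat 1 (k%:R * (x ord0 j - a ord0 j)) *
                 flat 1 (k%:R * (b ord0 j - x ord0 j))).

Lemma flat_ge0 (t : R) : 0 <= flat 1 t.
Proof. by rewrite /flat; case: ifP => // t0; rewrite hornerC mul1r expR_ge0. Qed.

Lemma flat_le1 (t : R) : flat 1 t <= 1.
Proof.
by rewrite /flat; case: ifP => // t0; rewrite hornerC mul1r expR_le1 oppr_le0 invr_ge0 ltW.
Qed.

Lemma flat_gt0 (t : R) : 0 < t -> 0 < flat 1 t.
Proof. by move=> t0; rewrite /flat t0 hornerC mul1r expR_gt0. Qed.

Lemma obump_ge0 k a b x : 0 <= obump k a b x.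
Proof. by apply: prodr_ge0 => j _; rewrite mulr_ge0 ?flat_ge0. Qed.

Lemma obump_le1 k a b x : obump k a b x <= 1.
Proof.
apply: prodr_ile1 => j _.
by rewrite mulr_ge0 ?flat_ge0//= mulr_ile1 ?flat_ge0 ?flat_le1.
Qed.

Lemma obump_gt0 k a b x : (0 < k)%N -> obox a b x -> 0 < obump k a b x.
Proof.
move=> k0 xab; apply: prodr_gt0 => j _; have /andP[h1 h2] := xab j.
by rewrite mulr_gt0// flat_gt0// mulr_gt0 ?ltr0n// subr_gt0.
Qed.

Lemma obump_out k a b x : ~ obox a b x -> obump k a b x = 0.
Proof.
move=> /existsNP[j /negP]; rewrite negb_and -!leNgt => h.
rewrite /obump (bigD1 j)//=.
suff -> : flat 1 (k%:R * (x ord0 j - a ord0 j)) * flat 1 (k%:R * (b ord0 j - x ord0 j)) = 0.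
  by rewrite mul0r.
case/orP: h => h.
  by rewrite {1}/flat ifF ?mul0r//; apply/negbTE; rewrite -leNgt mulr_ge0_le0// subr_le0.
by rewrite mulrC {1}/flat ifF ?mul0r//; apply/negbTE; rewrite -leNgt mulr_ge0_le0// subr_le0.
Qed.

Lemma flat_alg_obump k a b : flat_alg (obump k a b).
Proof.
suff H s : flat_alg (fun x => \prod_(j <- s) (flat 1 (k%:R * (x ord0 j - a ord0 j)) *
                 flat 1 (k%:R * (b ord0 j - x ord0 j)))) by exact: H.
elim: s => [|j s IH].
  by under eq_fun do rewrite big_nil; exact: flat_alg_cst.
under eq_fun do rewrite big_cons.
apply: flat_algM => //; apply: flat_algM.
  under eq_fun do rewrite mulrBr; exact: flat_alg_flat.
under eq_fun do rewrite mulrBr addrC -mulNr; exact: flat_alg_flat.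
Qed.

Lemma test_function_obump k a b : test_function (obump k a b).
Proof.
split; first by apply: flat_alg_smooth; exact: flat_alg_obump.
apply/compact_closure_supp; exists (`|a| + `|b|) => x bx.
have {bx} xab : obox a b x by apply: contrapT => /(@obump_out k) h; move: bx; rewrite /= h eqxx.
rewrite [leLHS]/Num.norm/= mx_normrE; apply/bigmax_leP; split => [|[i j] _ /=].
  by rewrite addr_ge0.
rewrite ord1; have /andP[h1 h2] := xab j.
have := ler_coord_norm a j; have := ler_coord_norm b j.
rewrite !ler_norml => /andP[h3 h4] /andP[h5 h6].
have := normr_ge0 a; have := normr_ge0 b => h7 h8.
by apply/andP; split; lra.
Qed.

Lemma obump_cvg a b x : (fun k => obump k a b x) @ \oo --> (\1_(obox a b) x : R).
Proof.
rewrite indicE; have [xab|xab] := pselect (obox a b x); last first.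
  rewrite memNset//; apply: cvg_near_cst; near=> k; exact: obump_out.
rewrite mem_set//=.
have cf (t : R) : 0 < t -> (fun k : nat => flat 1 (k%:R * t)) @ \oo --> (1 : R).
  move=> t0.
  have c0 : (fun k : nat => t^-1 * k%:R^-1) @ \oo --> t^-1 * 0.
    apply: (@cvgM _ _ \oo _ (cst t^-1) (fun k : nat => k%:R^-1)); first exact: cvg_cst.
    by rewrite -(@cvg_shiftS _ (fun k : nat => k%:R^-1 : R)); exact: cvg_harmonic.
  rewrite mulr0 in c0.
  have : (fun k : nat => expR (- (t^-1 * k%:R^-1))) @ \oo --> expR (- 0).
    by apply: (continuous_cvg _ _ (cvgN c0)); exact: continuous_expR.
  rewrite oppr0 expR0.
  apply: cvg_trans; apply: near_eq_cvg; near=> k.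
  rewrite /flat ifT ?hornerC ?mul1r ?invfM 1?[_ / t]mulrC// mulr_gt0// ltr0n.
  by near: k; exists 1%N.
rewrite (_ : 1%R = \prod_(j < n) (1 * 1 : R)); last by rewrite mulr1 big1_eq.
apply: (@cvg_big R 'I_n *%R 1 xpredT _ nat \oo (index_enum 'I_n)
  (fun j k => flat 1 (k%:R * (x ord0 j - a ord0 j)) * flat 1 (k%:R * (b ord0 j - x ord0 j)))
  (fun=> 1 * 1)).
  exact: mul_continuous.
move=> j _; have /andP[h1 h2] := xab j.
by apply: cvgM; apply: cf; rewrite subr_gt0.
Unshelve. all: by end_near. Qed.

End smooth_class.

(** * Fundamental lemma of the calculus of variations *)

Section density.
Context d (T : measurableType d) (R : realType).
Variables (mu : {measure set T -> \bar R}) (f : T -> \bar R).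
Hypotheses (mf : measurable_fun setT f) (f0 : forall x, (0 <= f x)%E).

Definition density (A : set T) := (\int[mu]_(x in A) f x)%E.

Let density0 : density set0 = 0%E.
Proof. exact: integral_set0. Qed.

Let density_ge0 A : (0 <= density A)%E.
Proof. exact: integral_ge0. Qed.

Let density_sigma_additive : semi_sigma_additive density.
Proof.
move=> /= F mF tF mUF; rewrite /density ge0_integral_bigcup//; last exact: measurable_funTS.
by apply: is_cvg_ereal_nneg_natsum_cond => n _ _; exact: integral_ge0.
Qed.

HB.instance Definition _ := isMeasure.Build _ _ _ density
  density0 density_ge0 density_sigma_additive.

Definition density_measure : {measure set T -> \bar R} := density.

End density.

Section fundamental_lemma.
Context {R : realType} (n : nat).
Notation E := 'rV[R]_n.
Notation mu := (@lebesgue_rV R n).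

(** The positive and negative parts of [D] are densities of two finite measures. They agree on
    boxes, hence on all measurable sets, and then the densities agree almost everywhere. *)
Lemma ae_eq0_obox (D : E -> R) : mu.-integrable setT (EFin \o D) ->
  (forall a b, \int[mu]_(x in obox a b) (D x)%:E = 0)%E ->
  {ae mu, forall x, D x = 0}.
Proof.
move=> iD D0.
have mD : measurable_fun setT (EFin \o D) by exact: measurable_int iD.
pose Dp := (EFin \o D)^\+%E; pose Dn := (EFin \o D)^\-%E.
have mDp : measurable_fun setT Dp by exact: measurable_funepos.
have mDn : measurable_fun setT Dn by exact: measurable_funeneg.
have Dp0 x : (0 <= Dp x)%E by exact: funepos_ge0.
have Dn0 x : (0 <= Dn x)%E by exact: funeneg_ge0.
have iDS A : measurable A -> mu.-integrable A (EFin \o D).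
  by move=> mA; exact: integrableS iD.
pose m1 := density_measure mu mDp Dp0.
pose m2 := density_measure mu mDn Dn0.
have fin1 A : measurable A -> (m1 A < +oo)%E.
  by move=> mA; exact: (integral_funepos_lt_pinfty mA (iDS _ mA)).
have m12 A : measurable A -> m1 A = m2 A.
  move=> /measurable_rV_obox.
  apply: (@g_sigma_algebra_measure_unique _ _ _ _ _
    (fun k => obox (const_mx (- k%:R)) (const_mx k%:R)) _ _ m1 m2).
  - by move=> _ [a [b ->]]; exact: measurable_obox.
  - by move=> k; exists (const_mx (- k%:R)), (const_mx k%:R).
  - exact: obox_bigcup.
  - by move=> _ _ [a [b ->]] [c [e ->]]; rewrite setI_obox; eexists; eexists.
  - move=> _ [a [b ->]]; have := D0 a b; rewrite integralE => /eqP.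
    rewrite sube_eq ?add0e; first by move/eqP.
      exact: (integrable_pos_fin_num (measurable_obox a b) (iDS _ (measurable_obox a b))).
    apply: fin_num_adde_defl.
    exact: (integrable_neg_fin_num (measurable_obox a b) (iDS _ (measurable_obox a b))).
  - by move=> k; apply: fin1; exact: measurable_obox.
have : ae_eq mu setT (EFin \o D) (cst 0%E).
  apply: integral_ae_eq => // A _ mA.
  rewrite integral0 integralE.
  have -> : (\int[mu]_(x in A) (EFin \o D)^\+ x = \int[mu]_(x in A) (EFin \o D)^\- x)%E := m12 A mA.
  by rewrite subee//; exact: (integrable_neg_fin_num mA (iDS _ mA)).
by apply: filterS => x /= /(_ I) [].
Qed.

(** Dominated convergence as [k] grows, with dominating function [|D|], since the bumps take values
    between 0 and 1. *)
Lemma integral_obox_eq0 (D : E -> R) a b : mu.-integrable setT (EFin \o D) ->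
  (forall k, \int[mu]_x (D x * obump k a b x) = 0) ->
  (\int[mu]_(x in obox a b) (D x)%:E = 0)%E.
Proof.
move=> iD D0.
have mD : measurable_fun setT D by apply/measurable_EFinP; exact: measurable_int iD.
have mb k : measurable_fun setT (obump k a b : E -> R).
  apply: continuous_measurable_rV.
  by have [/(_ [::])[]] := test_function_obump k a b.
have mo := measurable_obox a b.
have h1 k : measurable_fun setT (fun x => (D x * obump k a b x)%:E).
  by apply/measurable_EFinP; exact: measurable_funM.
have h2 : measurable_fun setT (fun x => (D x * \1_(obox a b) x)%:E).
  by apply/measurable_EFinP; apply: measurable_funM.
have [] := @dominated_convergence _ _ _ mu setT measurableT
   (fun k x => (D x * obump k a b x)%:E) (fun x => (D x * \1_(obox a b) x)%:E)
   (abse \o (EFin \o D)) h1 h2.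
- apply: aeW => x _; apply: cvg_EFin; first exact: nearW.
  apply: cvgM; [exact: cvg_cst|exact: obump_cvg].
- exact: integrable_abse.
- apply: aeW => x k _ /=; rewrite lee_fin normrM (ger0_norm (obump_ge0 _ _ _ _)).
  by rewrite ler_piMr// obump_le1.
move=> iDo _ cvo.
have Dk k : (\int[mu]_x (D x * obump k a b x)%:E = 0)%E.
  rewrite -[LHS]fineK; first by rewrite [fine _]D0.
  apply: integrable_fin_num => //; apply: le_integrable (iD) => // x _ /=.
  by rewrite lee_fin normrM (ger0_norm (obump_ge0 _ _ _ _)) ler_piMr// obump_le1.
have {}cvo : (fun=> 0%E : \bar R) @ \oo --> (\int[mu]_x (D x * \1_(obox a b) x)%:E)%E.
  by apply: cvg_trans cvo; apply: near_eq_cvg; apply: nearW => k; rewrite -[RHS](Dk k).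
rewrite integral_mkcond -[LHS](_ : (\int[mu]_x (D x * \1_(obox a b) x)%:E)%E = _); last first.
  apply: eq_integral => x _; rewrite patchE indicE; case: ifP => xo; first by rewrite mulr1.
  by rewrite mulr0.
by apply: (cvg_unique _ cvo); [exact: ereal_hausdorff|exact: cvg_cst].
Qed.

Lemma ae_eq0_obump (D : E -> R) a0 b0 : mu.-integrable setT (EFin \o D) ->
  (forall x, ~ obox a0 b0 x -> D x = 0) ->
  (forall k a b, obox a b `<=` obox a0 b0 -> \int[mu]_x (D x * obump k a b x) = 0) ->
  {ae mu, forall x, D x = 0}.
Proof.
move=> iD D0 Db; apply: ae_eq0_obox => // a b.
transitivity (\int[mu]_(x in obox a b `&` obox a0 b0) (D x)%:E)%E.
  rewrite integral_mkcond [RHS]integral_mkcond; apply: eq_integral => x _.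
  rewrite !patchE in_setI; case: ifP => //= _; case: ifPn => // /negP xab.
  by rewrite D0// => h; apply: xab; rewrite inE.
rewrite setI_obox; apply: integral_obox_eq0 => // k; apply: Db.
by rewrite -setI_obox; apply: subIsetr.
Qed.

End fundamental_lemma.

Section L2.
Context d (T : measurableType d) (R : realType) (mu : {measure set T -> \bar R}).

Lemma Lfun2P (f : T -> R) : f \in Lfun mu 2%:E <->
  measurable_fun setT f /\ (\int[mu]_x (f x ^+ 2)%:E < +oo)%E.
Proof.
split=> [fL|[mf f2]].
  split; first by have := sub_Lfun_mfun fL; rewrite inE.
  exact: (integrable_lty measurableT (Lfun2_integrable_sqr fL)).
rewrite inE; apply/andP; split; rewrite inE//=.
rewrite /finite_norm unlock /Lnorm poweR_lty//.
rewrite (eq_integral (fun x => (f x ^+ 2)%:E))// => x _ /=.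
by rewrite powR_mulrn // real_normK ?num_real.
Qed.

End L2.

Section test_functions.
Context {R : realType} (n : nat).
Notation E := 'rV[R]_n.
Notation mu := (@lebesgue_rV R n).

Lemma test_function_continuous (f : E -> R) : test_function f -> continuous f.
Proof. by move=> [/(_ [::])[]]. Qed.

Lemma test_function_measurable (f : E -> R) :
  test_function f -> measurable_fun setT f.
Proof. by move=> /test_function_continuous; exact: continuous_measurable_rV. Qed.

Lemma test_function_derivable (f : E -> R) i x :
  test_function f -> derivable f x (delta_mx 0 i).
Proof. by move=> [/(_ [::])[]]. Qed.

Lemma test_function_partial (f : E -> R) i :
  test_function f -> test_function (partial i f).
Proof.
move=> [sf /compact_closure_supp[M HM]]; split.
  by move=> s; have := sf (rcons s i); rewrite foldr_rcons.
apply/compact_closure_supp; exists M => x; apply: contraNle => Mx.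
rewrite /partial.
suff -> : 'D_(delta_mx 0 i) f x = 'D_(delta_mx 0 i) (cst 0 : E -> R) x.
  by rewrite derive_cst.
apply: near_eq_derive.
have : nbhs x [set y : E | M < `|y|].
  apply: open_nbhs_nbhs; split => //.
  apply: (@open_comp _ _ (fun x : E => `|x|) [set y : R | M < y]).
    by move=> y _; exact: norm_continuous.
  exact: open_gt.
apply: filterS => y My; apply/eqP; apply: contraTT My.
by rewrite -leNgt; exact: HM.
Qed.

Lemma test_function_bounded (f : E -> R) :
  test_function f -> exists2 C : R, 0 < C & forall x, `|f x| <= C.
Proof.
move=> tf; have cf := test_function_continuous tf.
have [_ cl] := tf.
have : compact (f @` closure [set x | f x != 0]).
  by apply: continuous_compact => //; apply: continuous_subspaceT.
move/compact_bounded => [M [_ HM]].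
exists (`|M| + 1); first by rewrite ltr_pwDr.
move=> x; have [->|fx] := eqVneq (f x) 0; first by rewrite normr0 addr_ge0.
apply: HM; first by rewrite (le_lt_trans (ler_norm _))// ltrDl.
by exists x => //; exact: subset_closure.
Qed.

Lemma test_function_Lfun2 (f : E -> R) : test_function f -> f \in Lfun mu 2%:E.
Proof.
move=> tf; have mf := test_function_measurable tf.
apply/Lfun2P; split => //.
have [C C0 HC] := test_function_bounded tf.
have [_ /compact_closure_supp[M HM]] := tf.
pose B := obox (const_mx (- (M + 1))) (const_mx (M + 1)) : set E.
have mB : measurable B by exact: measurable_obox.
apply: (@le_lt_trans _ _ (\int[mu]_x (C ^+ 2 * \1_B x)%:E)%E).
  apply: ge0_le_integral => //.
  - by move=> x _; rewrite lee_fin sqr_ge0.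
  - by apply/measurable_EFinP; exact: measurable_funX.
  - by apply/measurable_EFinP; apply: measurable_funM.
  move=> x _; rewrite lee_fin.
  have [->|fx] := eqVneq (f x) 0; first by rewrite expr0n/= mulr_ge0 ?sqr_ge0.
  rewrite indicE mem_set; last first.
    move=> i; rewrite !mxE -ltr_norml (le_lt_trans (ler_coord_norm _ _))//.
    by rewrite (le_lt_trans (HM _ fx))// ltrDl.
  by rewrite mulr1 -real_normK ?num_real// lerXn2r ?nnegrE// ltW.
under eq_integral do rewrite EFinM.
rewrite ge0_integralZl_EFin ?sqr_ge0//; last exact/measurable_EFinP.
rewrite integral_indic// setIT lte_mul_pinfty ?lee_fin ?sqr_ge0//.
exact: lebesgue_rV_obox_lty.
Qed.

Lemma is_derive_line (f : E -> R) (x v : E) (t : R) :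
  derivable f (x + t *: v) v ->
  is_derive t 1 (fun t : R => f (x + t *: v)) ('D_v f (x + t *: v)).
Proof.
move=> df.
have e : (fun h => h^-1 *: (((fun t : R => f (x + t *: v)) \o shift t) (h *: 1) - f (x + t *: v))) =
  (fun h => h^-1 *: ((f \o shift (x + t *: v)) (h *: v) - f (x + t *: v))).
  apply/funext => h /=; congr (_ *: (f _ - _)).
  by rewrite [h *: 1]mulr1 scalerDl addrCA.
split; first by rewrite /derivable e.
by rewrite /derive e.
Qed.

Lemma continuous_line (f : E -> R) (x v : E) :
  continuous f -> continuous (fun t : R => f (x + t *: v)).
Proof.
move=> cf t.
have cs : (fun t : R => x + t *: v) @ t --> x + t *: v.
  by apply: cvgD; [exact: cvg_cst|apply: cvgZr_tmp; exact: cvg_id].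
exact: (cvg_comp _ _ cs (cf _)).
Qed.

(** The interval is [[-s, 0]] because moving a translation by [+s] from [u] to the test function
    turns it into one by [-s]. *)
Lemma FTC_line (f : E -> R) i (x : E) (s : R) : 0 < s -> test_function f ->
  (\int[lebesgue_measure]_(t in `[(- s)%R, 0%R]) (partial i f (x + t *: delta_mx 0 i)%R)%:E
   = (f x - f (x - s *: delta_mx 0 i))%:E)%E.
Proof.
move=> s0 tf; set v := delta_mx 0 i.
have cf := continuous_line (x := x) (v := v) (test_function_continuous tf).
rewrite (@continuous_FTC2 _ _ (fun t => f (x + t *: v))).
- by rewrite scale0r addr0 scaleNr.
- by rewrite oppr_lt0.
- by apply: continuous_subspaceT; apply: continuous_line; apply: test_function_continuous; exact: test_function_partial.
- split.
  + by move=> t _; have [] := is_derive_line (@test_function_derivable f i (x + t *: v) tf).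
  + by apply: cvg_at_right_filter; exact: cf.
  + by apply: cvg_at_left_filter; exact: cf.
- by move=> t _; rewrite derive1E; have [_ ->] := is_derive_line (@test_function_derivable f i (x + t *: v) tf).
Qed.

End test_functions.

Section product_test.
Context {R : realType} (n : nat).
Notation E := 'rV[R]_n.
Notation mu := (@lebesgue_rV R n).

(* Products of smooth functions are not closed under [partial]; sums of such
   products are. *)
Inductive prod_smooth : (E -> R) -> Prop :=
| prod_smoothM f g : smooth f -> smooth g -> prod_smooth (fun x => f x * g x)
| prod_smoothD f g : prod_smooth f -> prod_smooth g -> prod_smooth (fun x => f x + g x).

Lemma smooth_partial i (f : E -> R) : smooth f -> smooth (partial i f).
Proof. by move=> sf s; have := sf (rcons s i); rewrite foldr_rcons. Qed.

Lemma prod_smooth_C1 f : prod_smooth f ->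
  continuous f /\ forall i x, derivable f x (delta_mx 0 i).
Proof.
elim=> {f} [f g sf sg|f g _ [cf df] _ [cg dg]].
  have [cf df] := sf [::]; have [cg dg] := sg [::]; split=> [x|i x].
    exact: (cvgM (cf x) (cg x)).
  by apply: derivableM; [exact: df|exact: dg].
split=> [x|i x]; first exact: (cvgD (cf x) (cg x)).
by apply: derivableD; [exact: df|exact: dg].
Qed.

Lemma prod_smooth_partial i f : prod_smooth f -> prod_smooth (partial i f).
Proof.
elim=> {f} [f g sf sg|f g pf IHf pg IHg].
  rewrite (_ : partial i _ = fun x => f x * partial i g x + g x * partial i f x).
    by apply: prod_smoothD; apply: prod_smoothM => //; exact: smooth_partial.
  apply/funext => x; have [_ df] := sf [::]; have [_ dg] := sg [::].
  by apply: deriveM; [exact: df|exact: dg].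
rewrite (_ : partial i _ = fun x => partial i f x + partial i g x).
  exact: prod_smoothD.
apply/funext => x; have [_ df] := prod_smooth_C1 pf; have [_ dg] := prod_smooth_C1 pg.
by apply: deriveD; [exact: df|exact: dg].
Qed.

Lemma test_functionM (f g : E -> R) :
  test_function f -> test_function g -> test_function (fun x => f x * g x).
Proof.
move=> [sf cf] [sg cg]; split.
  move=> s /=; have : prod_smooth (foldr (partial (n:=n)) (fun x => f x * g x) s).
    elim: s => [|i s IH] /=; first exact: prod_smoothM.
    exact: prod_smooth_partial.
  exact: prod_smooth_C1.
move: cf => /compact_closure_supp[M HM]; apply/compact_closure_supp; exists M => x.
by rewrite mulf_eq0 negb_or => /andP[/HM].
Qed.

End product_test.

(** * Weak derivatives *)

Section fubini_shift.
Context {R : realType} (n : nat).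
Notation E := 'rV[R]_n.
Notation mu := (@lebesgue_rV R n).
Notation lam := (@lebesgue_measure R).

Lemma integral_EFin_Rintegral (f : E -> R) : mu.-integrable setT (EFin \o f) ->
  (\int[mu]_x (f x)%:E = (\int[mu]_x f x)%R%:E)%E.
Proof. by move=> fi; rewrite fineK//; exact: integrable_fin_num. Qed.

Lemma Lfun2_integrableM (f g : E -> R) : f \in Lfun mu 2%:E -> g \in Lfun mu 2%:E ->
  mu.-integrable setT (fun x => (f x * g x)%:E).
Proof. by move=> f2 g2; apply/Lfun1_integrable; exact: Lfun2_mul_Lfun1. Qed.

Lemma Lfun_measurable (f : E -> R) p : f \in Lfun mu p -> measurable_fun setT f.
Proof. by move=> /sub_Lfun_mfun; rewrite inE. Qed.

Lemma Lfun2_shift (f : E -> R) y : f \in Lfun mu 2%:E ->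
  (fun x => f (x + y)) \in Lfun mu 2%:E.
Proof.
move=> /Lfun2P[mf f2]; apply/Lfun2P; split.
  exact: (measurableT_comp mf (measurable_shift y)).
rewrite (ge0_integral_shift y (f := fun x => (f x ^+ 2)%:E))//.
- by apply/measurable_EFinP; exact: measurable_funX.
- by move=> x; rewrite lee_fin sqr_ge0.
Qed.

Variables (u g : E -> R) (w : E) (s : R).
Hypotheses (u2 : u \in Lfun mu 2%:E) (g2 : g \in Lfun mu 2%:E).
Let I : set R := `[(- s)%R, 0%R].

Let mI : measurable_fun setT (\1_I : measurableTypeR R -> R).
Proof. by apply: measurable_indic; exact: measurable_itv. Qed.

Lemma measurable_shift_kernel :
  measurable_fun setT (fun z : E * measurableTypeR R => u z.1 * g (z.1 + (z.2 : R) *: w) * \1_I z.2).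
Proof.
have mu_ := Lfun_measurable u2; have mg := Lfun_measurable g2.
apply: measurable_funM; first apply: measurable_funM.
- exact: measurableT_comp.
- exact: (measurableT_comp mg (measurable_add_scale w)).
- exact: (measurableT_comp mI measurable_snd).
Qed.

(** For fixed [t], [|u(x) g(x + t w)| <= u(x)^2 + g(x + t w)^2], whose integral in [x] does not
    depend on [t] by translation invariance; [t] runs over an interval of finite length. *)
Lemma integrable_shift_kernel :
  (mu \x lam)%E.-integrable setT
    (fun z : E * measurableTypeR R => (u z.1 * g (z.1 + (z.2 : R) *: w) * \1_I z.2)%:E).
Proof.
have mk := measurable_shift_kernel.
have mk2 : measurable_fun setT (fun z : E * measurableTypeR R => (u z.1 * g (z.1 + (z.2 : R) *: w) * \1_I z.2)%:E).
  exact/measurable_EFinP.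
apply/(integrable21ltyP mu lam) => //.
have [mu_ uoo] := (Lfun2P mu u).1 u2; have [mg goo] := (Lfun2P mu g).1 g2.
set N := (\int[mu]_x (u x ^+ 2)%:E + \int[mu]_x (g x ^+ 2)%:E)%E.
have N0 : (0 <= N)%E.
  by apply: adde_ge0; apply: integral_ge0 => x _; rewrite lee_fin sqr_ge0.
have Noo : (N < +oo)%E by exact: lte_add_pinfty.
apply: (@le_lt_trans _ _ (\int[lam]_t (N * (\1_I t)%:E))%E).
  apply: ge0_le_integral => //.
  - by move=> t _; exact: integral_ge0.
  - pose k (z : E * measurableTypeR R) := (`|(u z.1 * g (z.1 + (z.2 : R) *: w) * \1_I z.2)%:E|)%E.
    have mk' : measurable_fun setT k by exact: measurableT_comp.
    exact: (@measurable_fun_fubini_tonelli_G _ _ _ _ _ mu k mk' (fun x => abse_ge0 _)).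
  - by apply: measurable_funeM; apply/measurable_EFinP; exact: mI.
  move=> t _.
  rewrite indicE; case: (t \in I) => /=; last first.
    by rewrite mule0 integral0_eq// => x _; rewrite /= mulr0 normr0.
  rewrite mule1 /N -(ge0_integral_shift ((t : R) *: w) (f := fun x => (g x ^+ 2)%:E)); last 2 first.
  - by apply/measurable_EFinP; exact: measurable_funX.
  - by move=> x; rewrite lee_fin sqr_ge0.
  have mgt : measurable_fun setT (fun x : E => g (x + (t : R) *: w)).
    exact: (measurableT_comp mg (measurable_shift _)).
  rewrite -ge0_integralD//; last 4 first.
  - by move=> x _; rewrite lee_fin sqr_ge0.
  - by apply/measurable_EFinP; exact: measurable_funX.
  - by move=> x _; rewrite lee_fin sqr_ge0.
  - by apply/measurable_EFinP; exact: (@measurable_funX _ _ _ _ (fun x : E => g (x + (t : R) *: w))).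
  apply: ge0_le_integral => //.
  - apply/measurable_EFinP; apply: measurableT_comp => //.
    by apply: measurable_funM => //; exact: measurable_funM.
  - apply/measurable_EFinP; apply: measurable_funD; exact: measurable_funX.
  move=> x _; rewrite mulr1 lee_fin normrM.
  rewrite -(real_normK (num_real (u x))) -(real_normK (num_real (g (x + (t : R) *: w)))).
  have := sqr_ge0 (`|u x| - `|g (x + t *: w)|).
  have := normr_ge0 (u x); have := normr_ge0 (g (x + t *: w)); nra.
rewrite ge0_integralZl//; last by apply/measurable_EFinP; exact: mI.
have mI' : measurable (I : set (measurableTypeR R)) by exact: measurable_itv.
rewrite integral_indic//.
have -> : (I : set (measurableTypeR R)) `&` setT = I by rewrite setIT.
have lI : (lam I < +oo)%E.
  by rewrite /I lebesgue_measure_itv/=; case: ifP => _; rewrite ?ltry.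
by rewrite lte_mul_pinfty// ge0_fin_numE.
Qed.

Lemma fubini_shift_kernel :
  (\int[mu]_x \int[lam]_t (u x * g (x + t *: w)%R * \1_I t)%:E =
   \int[lam]_t \int[mu]_x (u x * g (x + t *: w)%R * \1_I t)%:E)%E.
Proof. exact: (Fubini integrable_shift_kernel). Qed.

End fubini_shift.

(** * Difference quotients of weakly differentiable functions *)

Section weak_partial_shift.
Context {R : realType} (n : nat).
Notation E := 'rV[R]_n.
Notation mu := (@lebesgue_rV R n).
Notation lam := (@lebesgue_measure R).

Lemma integral_line (f : E -> R) (c : R) i (x : E) (s : R) : 0 < s -> test_function f ->
  (\int[lam]_t (c * partial i f (x + t *: delta_mx 0 i)%R * \1_(`[(- s)%R, 0%R]%classic) t)%:E
   = (c * (f x - f (x - s *: delta_mx 0 i)))%:E)%E.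
Proof.
move=> s0 tf; set v := delta_mx 0 i; set I := (X in \1_X).
have mI : measurable (I : set (measurableTypeR R)) by exact: measurable_itv.
have iI : lam.-integrable I (EFin \o (fun t : R => partial i f (x + t *: v))).
  apply: continuous_compact_integrable; first exact: segment_compact.
  apply: continuous_subspaceT; apply: continuous_line.
  by apply: test_function_continuous; exact: test_function_partial.
rewrite EFinM -(FTC_line i x s0 tf) -/v -(integralZl mI iI) [RHS]integral_mkcond.
apply: eq_integral => t _; rewrite patchE indicE -/I.
by case: (t \in I) => /=; rewrite ?mulr1 ?mulr0.
Qed.

(** The weak form of [u(x + s v) - u(x)] being the integral of [g(x + r v)] over [r] in [[0, s]],
    with [r = -t]. For each [t] the translate of [phi] by [t v] is a test function, so the
    definition of the weak derivative applies to it; Fubini before and after lets the fundamental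
    theorem of calculus act on [phi] instead of [u]. *)
Lemma weak_partial_shift (u g phi : E -> R) i (s : R) : 0 < s ->
  u \in Lfun mu 2%:E -> g \in Lfun mu 2%:E -> weak_partial i u g ->
  test_function phi ->
  (\int[mu]_x (phi x * (u (x + s *: delta_mx 0 i)%R - u x))%:E =
   \int[mu]_x \int[lam]_t
     (phi x * g (x + t *: (- delta_mx 0 i))%R * \1_(`[(- s)%R, 0%R]%classic) t)%:E)%E.
Proof.
move=> s0 u2 g2 ug tphi; set v := delta_mx 0 i; set I := (X in \1_X).
have mu_ := Lfun_measurable u2; have mg := Lfun_measurable g2.
have phi2 := test_function_Lfun2 tphi; have mphi := Lfun_measurable phi2.
have dphi2 := test_function_Lfun2 (test_function_partial i tphi).
have mdphi := Lfun_measurable dphi2.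
have Nu2 : (fun x => - u x) \in Lfun mu 2%:E by rewrite rpredN.
rewrite (fubini_shift_kernel _ _ phi2 g2).
transitivity (\int[lam]_t \int[mu]_x
   (- u x * partial i phi (x + t *: v)%R * \1_I t)%:E)%E; last first.
  apply: eq_integral => t _.
  rewrite indicE; case: (t \in I) => /=; last first.
    by under eq_integral do rewrite mulr0; under [in RHS]eq_integral do rewrite mulr0.
  under eq_integral do rewrite mulr1; under [in RHS]eq_integral do rewrite mulr1.
  have phit2 := Lfun2_shift ((t : R) *: v) phi2.
  have dphit2 := Lfun2_shift ((t : R) *: v) dphi2.
  transitivity (\int[mu]_x (g x * phi (x + (t : R) *: v)%R)%:E)%E; last first.
    rewrite -(integral_shift ((t : R) *: v) (f := fun x => (phi x * g (x + (t : R) *: - v))%:E)).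
      by apply: eq_integral => x _; rewrite scalerN addrK mulrC.
    apply/measurable_EFinP; apply: measurable_funM => //.
    exact: (measurableT_comp mg (measurable_shift _)).
  under eq_integral do rewrite mulNr EFinN.
  rewrite integralN/=; last first.
    by apply: integrable_add_def => //; exact: Lfun2_integrableM.
  rewrite !integral_EFin_Rintegral; [|exact: Lfun2_integrableM..].
  have := ug _ (test_function_shift ((t : R) *: v) tphi).
  by rewrite partial_shift => ->; rewrite EFinN oppeK.
rewrite -(fubini_shift_kernel _ _ Nu2 dphi2).
under [in RHS]eq_integral do rewrite integral_line//.
have us2 := Lfun2_shift (s *: v) u2.
have phis2 := Lfun2_shift (- (s *: v)) phi2.
transitivity (\int[mu]_x (phi x * u (x + s *: v)%R)%:E - \int[mu]_x (phi x * u x)%:E)%E.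
  rewrite -integralB_EFin//; [|exact: Lfun2_integrableM..].
  by apply: eq_integral => x _; rewrite -EFinB mulrBr.
transitivity (\int[mu]_x (u x * phi (x - s *: v)%R)%:E - \int[mu]_x (phi x * u x)%:E)%E.
  congr (_ - _)%E.
  rewrite -(integral_shift (s *: v) (f := fun x => (u x * phi (x - s *: v))%:E)).
    by apply: eq_integral => x _; rewrite addrK mulrC.
  apply/measurable_EFinP; apply: measurable_funM => //.
  exact: (measurableT_comp mphi (measurable_shift _)).
rewrite -integralB_EFin//; [|exact: Lfun2_integrableM..].
apply: eq_integral => x _; rewrite -EFinB; congr (_%:E); ring.
Qed.

End weak_partial_shift.

Section jensen.
Context d (T : measurableType d) (R : realType) (mu : {measure set T -> \bar R}).

(** Integrate [2 c h <= h^2 + c^2] over [A] with [c] the mean of [h]. The case of an infinite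
    right-hand side is removed first, so that [h] is integrable on [A] and [fine] returns its actual
    integral. *)
Lemma sqr_integral_le (A : set T) (h : T -> R) (s : R) : 0 < s -> measurable A ->
  mu A = s%:E -> measurable_fun setT h ->
  ((fine (\int[mu]_t (h t * \1_A t)%:E) ^+ 2)%:E <=
   s%:E * \int[mu]_t (h t ^+ 2 * \1_A t)%:E)%E.
Proof.
move=> s0 mA muA mh.
have m1 : measurable_fun setT (\1_A : T -> R) by exact: measurable_indic.
have mq : measurable_fun setT (fun t => (h t ^+ 2 * \1_A t)%:E).
  by apply/measurable_EFinP; apply: measurable_funM => //; exact: measurable_funX.
have q0 t : (0 <= (h t ^+ 2 * \1_A t)%:E)%E by rewrite lee_fin mulr_ge0 ?sqr_ge0.
set q := (\int[mu]_t (h t ^+ 2 * \1_A t)%:E)%E.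
have [qoo|] := ltP q +oo%E; last first.
  by rewrite leye_eq => /eqP ->; rewrite gt0_muley ?leey// lte_fin.
have iq : mu.-integrable setT (fun t => (h t ^+ 2 * \1_A t)%:E).
  apply/integrableP; split => //.
  by under eq_integral do rewrite gee0_abs//.
have iA : mu.-integrable setT (fun t => (\1_A t)%:E : \bar R).
  apply/integrableP; split; first exact/measurable_EFinP.
  under eq_integral do rewrite gee0_abs ?lee_fin//.
  by rewrite integral_indic// setIT muA ltry.
have i1 c : mu.-integrable setT (fun t => (c * \1_A t)%:E).
  exact: (integrableZl measurableT c iA).
have int1 c : (\int[mu]_t (c * \1_A t)%:E = (c * s)%:E)%E.
  under eq_integral do rewrite EFinM.
  rewrite integralZl//.
  by rewrite integral_indic// setIT muA.
have ih : mu.-integrable setT (fun t => (h t * \1_A t)%:E).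
  apply: (@le_integrable _ _ _ mu setT measurableT _
    (fun t => (h t ^+ 2 * \1_A t)%:E + (1 * \1_A t)%:E)%E).
  - by apply/measurable_EFinP; exact: measurable_funM.
  - move=> t _ /=; rewrite lee_fin indicE; case: (t \in A) => /=.
      rewrite !mulr1 [leRHS]ger0_norm ?addr_ge0 ?sqr_ge0//.
      rewrite -[h t ^+ 2]real_normK ?num_real//.
      have := sqr_ge0 (`|h t| - 1); have := normr_ge0 (h t); nra.
    by rewrite !mulr0 normr0.
  - exact: integrableD.
set J := fine _.
have JE : (\int[mu]_t (h t * \1_A t)%:E = J%:E)%E.
  by rewrite fineK//; exact: integrable_fin_num.
have qE : q = (fine q)%:E by rewrite fineK// ge0_fin_numE// integral_ge0.
pose c := J / s.
have : ((2 * c * J)%:E <= (fine q + c ^+ 2 * s)%:E)%E.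
  rewrite EFinD -qE -int1 /q -(integralD measurableT iq (i1 _)).
  rewrite [(2 * c * J)%:E]EFinM -JE -integralZl//.
  apply: le_integral => //.
  - exact: integrableZl.
  - apply: integrableD => //; exact: i1.
  move=> t _; rewrite -EFinM -EFinD lee_fin indicE; case: (t \in A) => /=.
    by rewrite !mulr1; have := sqr_ge0 (h t - c); nra.
  by rewrite !mulr0 addr0.
rewrite qE -EFinM !lee_fin /c => H.
have H1 : (J / s) ^+ 2 * s = J ^+ 2 / s by field; rewrite gt_eqF.
have H2 : 2 * (J / s) * J = 2 * (J ^+ 2 / s) by ring.
rewrite H1 H2 in H.
have : J ^+ 2 / s <= fine q by lra.
by rewrite ler_pdivrMr// mulrC.
Qed.

End jensen.

Section weak_partial_estimates.
Context {R : realType} (n : nat).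
Notation E := 'rV[R]_n.
Notation mu := (@lebesgue_rV R n).
Notation lam := (@lebesgue_measure R).

Let B k : set E := obox (const_mx (- k%:R)) (const_mx k%:R).

Lemma Lfun2B (f g : E -> R) : f \in Lfun mu 2%:E -> g \in Lfun mu 2%:E ->
  (fun x => f x - g x) \in Lfun mu 2%:E.
Proof. by move=> f2 g2; rewrite (_ : (fun x => _) = f - g)//; apply: rpredB => //; rewrite lee1n. Qed.

Lemma Lfun2_indic_obox (a b : E) : (\1_(obox a b) : E -> R) \in Lfun mu 2%:E.
Proof.
have mo := measurable_obox a b.
apply/Lfun2P; split; first exact: measurable_indic.
under eq_integral => x _.
  have -> : (\1_(obox a b) x ^+ 2 : R) = \1_(obox a b) x.
    by rewrite indicE; case: (_ \in _); rewrite ?expr1n ?expr0n.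
  over.
by rewrite integral_indic// setIT lebesgue_rV_obox_lty.
Qed.

Lemma obumpE k (a b a' b' x : E) : obox a b `<=` obox a' b' ->
  \1_(obox a' b') x * obump k a b x = obump k a b x.
Proof.
move=> ab; have [xab|xab] := pselect (obox a b x).
  by rewrite indicE mem_set ?mul1r//; exact: ab.
by rewrite obump_out// mulr0.
Qed.

Lemma ae_obox (P : E -> Prop) :
  (forall k, {ae mu, forall x, B k x -> P x}) -> {ae mu, forall x, P x}.
Proof.
move=> /ae_foralln; apply: filterS => x Px.
have : [set: E] x by [].
by rewrite -obox_bigcup => -[k _]; exact: Px.
Qed.

Lemma weak_partial_unique (u g1 g2 : E -> R) i :
  g1 \in Lfun mu 2%:E -> g2 \in Lfun mu 2%:E ->
  weak_partial i u g1 -> weak_partial i u g2 -> {ae mu, forall x, g1 x = g2 x}.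
Proof.
move=> L1 L2 w1 w2; apply: ae_obox => k.
have LB := Lfun2_indic_obox (const_mx (- k%:R)) (const_mx k%:R); rewrite -/(B k) in LB.
have L12 : (fun x => g1 x - g2 x) \in Lfun mu 2%:E by exact: Lfun2B.
have : {ae mu, forall x, \1_(B k) x * (g1 x - g2 x) = 0}.
  apply: (@ae_eq0_obump _ _ _ (const_mx (- k%:R)) (const_mx k%:R)).
  - exact: Lfun2_integrableM.
  - by move=> x Bx; rewrite indicE memNset// mul0r.
  move=> j a b ab.
  have tb := test_function_obump j a b.
  have L3 := test_function_Lfun2 tb.
  under eq_Rintegral => x _ do rewrite mulrAC obumpE// mulrBr ![obump j a b x * _]mulrC.
  rewrite RintegralB//; [|exact: Lfun2_integrableM..].
  have /eqP := w1 _ tb; rewrite -(inj_eq oppr_inj) opprK => /eqP <-.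
  have /eqP := w2 _ tb; rewrite -(inj_eq oppr_inj) opprK => /eqP <-.
  by rewrite subrr.
apply: filterS => x + Bx; rewrite indicE mem_set// mul1r => /eqP.
by rewrite subr_eq0 => /eqP.
Qed.

(** By [weak_partial_shift] and the fundamental lemma, [u(x + s v) - u(x)] is for almost every [x]
    the integral of [g] along the segment from [x] to [x + s v]. The inequality [sqr_integral_le] on
    the segment, Tonelli and translation invariance then give one factor [s] each. *)
Lemma weak_partial_diff (u g : E -> R) i (s : R) : 0 <= s ->
  u \in Lfun mu 2%:E -> g \in Lfun mu 2%:E -> weak_partial i u g ->
  (\int[mu]_x ((u (x + s *: delta_mx 0 i)%R - u x) ^+ 2)%:E <=
   (s ^+ 2)%:E * \int[mu]_x (g x ^+ 2)%:E)%E.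
Proof.
move=> s0 u2 g2 ug.
have g2_ge0 : (0 <= \int[mu]_x (g x ^+ 2)%:E)%E.
  by apply: integral_ge0 => x _; rewrite lee_fin sqr_ge0.
have [->|sn0] := eqVneq s 0.
  under eq_integral do rewrite scale0r addr0 subrr expr0n/=.
  by rewrite integral0 mule_ge0 ?lee_fin ?sqr_ge0.
have {s0 sn0} s0 : 0 < s by rewrite lt_def sn0.
set v := delta_mx 0 i; set I := `[(- s)%R, 0%R]%classic : set R.
have mI : measurable (I : set (measurableTypeR R)) by exact: measurable_itv.
have m1I : measurable_fun setT (\1_I : measurableTypeR R -> R) by exact: measurable_indic.
have lI : lam I = s%:E.
  by rewrite /I lebesgue_measure_itv/= lte_fin oppr_lt0 s0 -EFinB sub0r opprK.
have mg := Lfun_measurable g2; have mu_ := Lfun_measurable u2.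
pose W x := u (x + s *: v) - u x.
have us2 := Lfun2_shift (s *: v) u2.
have W2 : W \in Lfun mu 2%:E by exact: Lfun2B.
have mgl (x : E) : measurable_fun setT (fun t : measurableTypeR R => g (x + (t : R) *: - v)).
  have mm : measurable_fun setT (fun t : measurableTypeR R => (x, t)) by exact: measurable_pair1.
  exact: (measurableT_comp mg (measurableT_comp (measurable_add_scale (- v)) mm)).
pose H (x : E) := (\int[lam]_t (g (x + (t : R) *: - v)%R ^+ 2 * \1_I t)%:E)%E.
have mker : measurable_fun setT (fun z : E * measurableTypeR R =>
    (g (z.1 + (z.2 : R) *: - v) ^+ 2 * \1_I z.2)%:E).
  apply/measurable_EFinP; apply: measurable_funM; last exact: (measurableT_comp m1I measurable_snd).
  apply: measurable_funX; exact: (measurableT_comp mg (measurable_add_scale _)).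
have ker0 (z : E * measurableTypeR R) : (0 <= (g (z.1 + (z.2 : R) *: - v) ^+ 2 * \1_I z.2)%:E)%E.
  by rewrite lee_fin mulr_ge0 ?sqr_ge0.
have mH : measurable_fun setT H.
  exact: (@measurable_fun_fubini_tonelli_F _ _ _ _ _ lam _ mker ker0).
have H0 x : (0 <= H x)%E by apply: integral_ge0 => t _; rewrite lee_fin mulr_ge0 ?sqr_ge0.
have key : {ae mu, forall x, (W x ^+ 2)%:E <= s%:E * H x}%E.
  apply: ae_obox => k.
  have LB := Lfun2_indic_obox (const_mx (- k%:R)) (const_mx k%:R); rewrite -/(B k) in LB.
  have iK := integrable_shift_kernel (- v) s LB g2.
  pose F (x : E) := (\int[lam]_t (\1_(B k) x * g (x + (t : R) *: - v)%R * \1_I t)%:E)%E.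
  have iF : mu.-integrable setT F by exact: (integrable_fubini_F iK).
  (* [F] is finite only almost everywhere; the fundamental lemma speaks of real-valued functions. *)
  pose G x := fine (F x).
  have iG : mu.-integrable setT (EFin \o G).
    apply: le_integrable (iF) => //.
    - apply/measurable_EFinP; apply: (measurableT_comp _ (measurable_int _ iF)).
      exact: fine_measurable.
    - by move=> x _; rewrite /= /G; case: (F x) => [r||] /=; rewrite ?normr0 ?leey.
  have iBW := Lfun2_integrableM LB W2.
  have : {ae mu, forall x, \1_(B k) x * W x - G x = 0}.
    apply: (@ae_eq0_obump _ _ _ (const_mx (- k%:R)) (const_mx k%:R)).
    - exact: (integrableB _ iBW iG).
    - move=> x Bx; rewrite indicE memNset// mul0r sub0r /G /F.
      under eq_integral do rewrite indicE memNset// !mul0r.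
      by rewrite integral0 oppr0.
    move=> j a b ab.
    have tb := test_function_obump j a b.
    have L3 := test_function_Lfun2 tb.
    have ikb := integrable_shift_kernel (- v) s L3 g2.
    have Gb : (\int[mu]_x (G x * obump j a b x)%:E =
      \int[mu]_x (\int[lam]_t (obump j a b x * g (x + (t : R) *: - v)%R * \1_I t)%:E))%E.
      apply: ae_eq_integral => //.
      - apply/measurable_EFinP; apply: measurable_funM; last exact: test_function_measurable.
        by apply/measurable_EFinP; exact: measurable_int iG.
      - exact: measurable_int (integrable_fubini_F ikb).
      (* Pulling the bump into the inner integral requires the kernel to be integrable in [t], which
         Fubini provides for almost every [x]. *)
      have := ae_integrable1 iK; apply: filterS => x iKx _.
      transitivity (\int[lam]_t ((obump j a b x)%:E *
         (\1_(B k) x * g (x + (t : R) *: - v)%R * \1_I t)%:E))%E.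
        rewrite integralZl// EFinM muleC /G fineK//.
        exact: (integrable_fin_num measurableT iKx).
      by apply: eq_integral => t _; rewrite -EFinM !mulrA [_ * \1_(B k) x]mulrC obumpE.
    have iGb : mu.-integrable setT (fun x => (G x * obump j a b x)%:E).
      apply: le_integrable (iG) => //.
        apply/measurable_EFinP; apply: measurable_funM; last exact: test_function_measurable.
        by apply/measurable_EFinP; exact: measurable_int iG.
      move=> x _ /=; rewrite lee_fin normrM (ger0_norm (obump_ge0 _ _ _ _)).
      by rewrite ler_piMr// obump_le1.
    have iWb := Lfun2_integrableM L3 W2.
    under eq_Rintegral => x _ do rewrite mulrBl mulrAC obumpE//.
    rewrite RintegralB//; apply/eqP; rewrite subr_eq0; apply/eqP.
    by rewrite /Rintegral Gb (weak_partial_shift s0 u2 g2 ug tb).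
  apply: filterS => x + Bx.
  rewrite indicE mem_set// mul1r => /eqP; rewrite subr_eq0 => /eqP ->.
  rewrite /G /F; under eq_integral do rewrite indicE mem_set// mul1r.
  exact: (sqr_integral_le s0 mI lI (mgl x)).
apply: (@le_trans _ _ (\int[mu]_x (s%:E * H x))%E).
  apply: ae_ge0_le_integral => //.
  - by move=> x _; rewrite lee_fin sqr_ge0.
  - by apply/measurable_EFinP; apply: measurable_funX; exact: Lfun_measurable W2.
  - by move=> x _; rewrite mule_ge0// lee_fin ltW.
  - exact: measurable_funeM.
  - by apply: filterS key => x h _.
rewrite ge0_integralZl//; last by rewrite lee_fin ltW.
rewrite expr2 EFinM -muleA lee_pmul2l//.
rewrite /H (fubini_tonelli _ mker ker0).
(* For every [t] the inner integral is that of [g^2], and [I] has length [s]: this is the second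
   factor [s]. *)
rewrite (_ : (\int[lam]_t _ = \int[lam]_t ((\int[mu]_x (g x ^+ 2)%:E) * (\1_I t)%:E))%E).
  rewrite ge0_integralZl//; last by apply/measurable_EFinP; exact: m1I.
  rewrite integral_indic//.
  have -> : (I : set (measurableTypeR R)) `&` setT = I by rewrite setIT.
  by rewrite -[s%:E]lI muleC.
apply: eq_integral => t _ /=.
rewrite -(ge0_integral_shift ((t : R) *: - v) (f := fun x => (g x ^+ 2)%:E)); last 2 first.
- by apply/measurable_EFinP; exact: measurable_funX.
- by move=> x; rewrite lee_fin sqr_ge0.
rewrite -ge0_integralZr//.
- by apply/measurable_EFinP; apply: (measurable_funX (f := fun x : E => g (x + (t : R) *: - v))); exact: (measurableT_comp mg (measurable_shift _)).
- by move=> x _; rewrite lee_fin sqr_ge0.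
Qed.

End weak_partial_estimates.

(** * The space H^1: scaling, translation, test functions *)

Section H1_theory.
Context {R : realType} (n : nat).
Notation E := 'rV[R]_n.
Notation mu := (@lebesgue_rV R n).
Implicit Types (u g : E -> R).

Lemma H1_Lfun2 u : H1 u -> u \in Lfun mu 2%:E.
Proof. by case. Qed.

Lemma wpartialP u i : H1 u ->
  wpartial i u \in Lfun mu 2%:E /\ weak_partial i u (wpartial i u).
Proof.
move=> [_ /(_ i)[g g2 ug]]; apply: (@xgetPex _ (cst 0)
  [set g | g \in Lfun mu 2%:E /\ weak_partial i u g]).
by exists g.
Qed.

Lemma wpartial_ae u g i : H1 u -> g \in Lfun mu 2%:E -> weak_partial i u g ->
  {ae mu, forall x, wpartial i u x = g x}.
Proof.
by move=> /(wpartialP i)[h1 h2] g2 ug; exact: weak_partial_unique h1 g2 h2 ug.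
Qed.

Lemma weak_partialZ u g i (c : R) : u \in Lfun mu 2%:E -> g \in Lfun mu 2%:E ->
  weak_partial i u g -> weak_partial i (fun x => c * u x) (fun x => c * g x).
Proof.
move=> u2 g2 ug phi tphi.
have phi2 := test_function_Lfun2 tphi.
have dphi2 := test_function_Lfun2 (test_function_partial i tphi).
under eq_Rintegral do rewrite -mulrA.
under [in RHS]eq_Rintegral do rewrite -mulrA.
rewrite RintegralZl//; last exact: Lfun2_integrableM.
rewrite RintegralZl//; last exact: Lfun2_integrableM.
by rewrite (ug _ tphi) mulrN.
Qed.

Lemma weak_partial_translate u g i y : u \in Lfun mu 2%:E -> g \in Lfun mu 2%:E ->
  weak_partial i u g -> weak_partial i (fun x => u (x + y)) (fun x => g (x + y)).
Proof.
move=> u2 g2 ug phi tphi.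
have mu_ := Lfun_measurable u2; have mg := Lfun_measurable g2.
have h (f psi : E -> R) : measurable_fun setT f -> test_function psi ->
    \int[mu]_x (f (x + y) * psi x) = \int[mu]_x (f x * psi (x - y)).
  move=> mf tpsi.
  rewrite -(Rintegral_shift y (f := fun x => f x * psi (x - y))).
    by apply: eq_Rintegral => x _; rewrite addrK.
  apply: measurable_funM => //.
  by apply: test_function_measurable; exact: test_function_shift.
rewrite h//; last exact: test_function_partial.
rewrite h// -(ug _ (test_function_shift (- y) tphi)).
by rewrite partial_shift.
Qed.

Lemma Lfun2Z u (c : R) : u \in Lfun mu 2%:E -> (fun x => c * u x) \in Lfun mu 2%:E.
Proof.
move=> u2; rewrite (_ : (fun x => _) = c \o* u).
  by apply: Lfun_scale u2; rewrite ler1n.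
by apply/funext => x /=; rewrite mulrC.
Qed.

Lemma H1Z u (c : R) : H1 u -> H1 (fun x => c * u x).
Proof.
move=> uH; split; first by apply: Lfun2Z; exact: H1_Lfun2.
move=> i; have [h1 h2] := wpartialP i uH.
exists (fun x => c * wpartial i u x); first exact: Lfun2Z.
by apply: weak_partialZ => //; exact: H1_Lfun2.
Qed.

Lemma H1_translate u y : H1 u -> H1 (fun x => u (x + y)).
Proof.
move=> uH; split; first by apply: Lfun2_shift; exact: H1_Lfun2.
move=> i; have [h1 h2] := wpartialP i uH.
exists (fun x => wpartial i u (x + y)); first exact: Lfun2_shift.
by apply: weak_partial_translate => //; exact: H1_Lfun2.
Qed.

Lemma obox_normP (M : R) (x : E) : `|x| < M -> obox (const_mx (- M)) (const_mx M) x.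
Proof. by move=> xM i; rewrite !mxE -ltr_norml (le_lt_trans (ler_coord_norm _ _)). Qed.

(* [F - F (. - v)] has integral 0 by translation invariance, and by FTC and Fubini
   that integral is also the integral of [partial i F]. *)
Lemma Rintegral_partial0 (F : E -> R) i : test_function F -> \int[mu]_x partial i F x = 0.
Proof.
move=> tF; have tdF := test_function_partial i tF.
have [_ /compact_closure_supp[M1 HM1]] := tF.
have [_ /compact_closure_supp[M2 HM2]] := tdF.
set v := delta_mx 0 i : E.
pose M := `|M1| + `|M2| + `|v| + 1.
have LB := Lfun2_indic_obox (const_mx (- M)) (const_mx M : E).
have dF2 := test_function_Lfun2 tdF.
have F2 := test_function_Lfun2 tF.
have inB (f : E -> R) (t : R) (x : E) : (forall y, f y != 0 -> `|y| <= `|M1| + `|M2|) -> `|t| <= 1 ->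
    \1_(obox (const_mx (- M)) (const_mx M)) x * f (x + t *: v) = f (x + t *: v).
  move=> Hf t1; have [->|/Hf fx] := eqVneq (f (x + t *: v)) 0; first by rewrite mulr0.
  rewrite indicE mem_set ?mul1r//; apply: obox_normP.
  rewrite -[x](addrK (t *: v)) (le_lt_trans (ler_normB _ _))// normrZ.
  have : `|t| * `|v| <= `|v| by rewrite ler_piMl.
  rewrite /M; lra.
have h1 y : F y != 0 -> `|y| <= `|M1| + `|M2|.
  by move=> /HM1 h; rewrite (le_trans h)// (le_trans (ler_norm _))// lerDl.
have h2 y : partial i F y != 0 -> `|y| <= `|M1| + `|M2|.
  by move=> /HM2 h; rewrite (le_trans h)// (le_trans (ler_norm _))// lerDr.
have := fubini_shift_kernel v 1 LB dF2.
under [in LHS]eq_integral => x _.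
  rewrite integral_line// scale1r mulrBr.
  have := inB F 0 x h1; rewrite scale0r addr0 normr0 => ->//.
  have := inB F (- 1) x h1; rewrite scaleN1r normrN1 => ->//.
  over.
have iT (f : E -> R) : test_function f -> (forall y, f y != 0 -> `|y| <= `|M1| + `|M2|) ->
    mu.-integrable setT (fun x => (f x)%:E).
  move=> tf Hf; apply: eq_integrable (Lfun2_integrableM LB (test_function_Lfun2 tf)) => // x _.
  by have := inB f 0 x Hf; rewrite scale0r addr0 normr0 => ->.
have iF := iT _ tF h1; have idF := iT _ tdF h2.
rewrite [X in X = _](_ : _ = 0%E); last first.
  rewrite integralB_EFin//; last exact: (integrable_shift (- v) iF).
  rewrite (integral_shift (- v) (f := EFin \o F)); last exact: measurable_int iF.
  by rewrite subee//; exact: (integrable_fin_num measurableT iF).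
move=> /esym.
rewrite (eq_integral (fun t : measurableTypeR R => ((\int[mu]_x partial i F x)%:E * (\1_`[(- 1)%R, 0%R] t)%:E)%E)); last first.
  move=> t _ /=.
  have -> : (\1_(`[(- 1)%R, 0%R]%classic) t : R) = (t \in (`[(- 1)%R, 0%R]%classic : set R))%:R by rewrite indicE.
  have [|] := boolP (t \in `[(- 1)%R, 0%R]%classic); last first.
    by move=> _; rewrite mule0 integral0_eq// => x _; rewrite mulr0.
  rewrite inE/= in_itv/= mule1 => /andP[t1 t2].
  rewrite -integral_EFin_Rintegral// -(integral_shift (t *: v) (f := EFin \o partial i F)); last exact: measurable_int idF.
  apply: eq_integral => x _ /=; rewrite mulr1 inB//.
  by rewrite ler_norml t1 (le_trans t2).
rewrite integralZl//; last first.
  have := @integrable_indic_itv R (-1) 0 true false; exact.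
have mI : measurable (`[(- 1)%R, 0%R]%classic : set (measurableTypeR R)) by exact: measurable_itv.
rewrite integral_indic//.
have -> : (`[(- 1)%R, 0%R]%classic : set (measurableTypeR R)) `&` setT = `[(- 1)%R, 0%R]%classic by rewrite setIT.
rewrite [X in (_ * X)%E](_ : _ = 1%E); last first.
  apply: (etrans (lebesgue_measure_itv _)).
  by rewrite /= lte_fin ltrN10 -EFinB sub0r opprK.
by rewrite mule1 => -[].
Qed.

(** Integration by parts: the product of [u] with a test function is a test function, and the
    integral of its partial derivative is 0. *)
Lemma H1_test u : test_function u -> H1 u.
Proof.
move=> tu; have u2 := test_function_Lfun2 tu; split=> // i.
have tdu := test_function_partial i tu; have du2 := test_function_Lfun2 tdu.
exists (partial i u) => // phi tphi.
have tdphi := test_function_partial i tphi.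
have phi2 := test_function_Lfun2 tphi; have dphi2 := test_function_Lfun2 tdphi.
have := Rintegral_partial0 i (test_functionM tu tphi).
under eq_Rintegral => x _.
  have := @deriveM _ _ u phi x (delta_mx 0 i) (test_function_derivable tu) (test_function_derivable tphi).
  rewrite /GRing.scale/= /partial => ->; over.
rewrite RintegralD//; [|exact: Lfun2_integrableM..].
move/eqP; rewrite addr_eq0 => /eqP ->; congr (- _).
by apply: eq_Rintegral => x _; rewrite mulrC.
Qed.

End H1_theory.

(** * The H^1 norm and translations in L^2 *)

Section gradient.
Context {R : realType} (n : nat).
Notation E := 'rV[R]_n.
Notation mu := (@lebesgue_rV R n).
Implicit Types (u : E -> R).

Definition grad2 u (x : E) : R := \sum_i wpartial i u x ^+ 2.

Lemma grad2_ge0 u x : 0 <= grad2 u x.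
Proof. by apply: sumr_ge0 => i _; rewrite sqr_ge0. Qed.

Lemma measurable_grad2 u : H1 u -> measurable_fun setT (grad2 u).
Proof.
move=> uH; apply: measurable_sum => i; apply: measurable_funX.
by have [h _] := wpartialP i uH; exact: Lfun_measurable h.
Qed.

Lemma H1_measurable u : H1 u -> measurable_fun setT u.
Proof. by move=> /H1_Lfun2; exact: Lfun_measurable. Qed.

(** [wpartial] is an arbitrary choice of weak derivative. Any explicit one agrees with it almost
    everywhere, which is how scaled and translated functions are handled. *)
Lemma grad2_ae u (g : 'I_n -> E -> R) : H1 u ->
  (forall i, g i \in Lfun mu 2%:E) -> (forall i, weak_partial i u (g i)) ->
  {ae mu, forall x, grad2 u x = \sum_i g i x ^+ 2}.
Proof.
move=> uH g2 ug.
have : {ae mu, forall x, forall i, wpartial i u x = g i x}.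
  by apply: filter_forall => i; exact: wpartial_ae.
by apply: filterS => x h; apply: eq_bigr => i _; rewrite h.
Qed.

Lemma grad2Z u c : H1 u ->
  {ae mu, forall x, grad2 (fun y => c * u y) x = c ^+ 2 * grad2 u x}.
Proof.
move=> uH; have wP i := wpartialP i uH.
have := @grad2_ae _ (fun i x => c * wpartial i u x) (H1Z c uH).
move=> /(_ (fun i => Lfun2Z c (wP i).1) (fun i => weak_partialZ c (H1_Lfun2 uH) (wP i).1 (wP i).2)).
by apply: filterS => x ->; rewrite mulr_sumr; apply: eq_bigr => i _; rewrite exprMn.
Qed.

Lemma grad2_translate u y : H1 u ->
  {ae mu, forall x, grad2 (fun z => u (z + y)) x = grad2 u (x + y)}.
Proof.
move=> uH; have wP i := wpartialP i uH.
have := @grad2_ae _ (fun i x => wpartial i u (x + y)) (H1_translate y uH).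
exact: (fun h => h (fun i => Lfun2_shift y (wP i).1)
  (fun i => weak_partial_translate y (H1_Lfun2 uH) (wP i).1 (wP i).2)).
Qed.

(** The square of the H^1 norm. *)
Definition H1_energy u : \bar R := (\int[mu]_x (grad2 u x + u x ^+ 2)%:E)%E.

Lemma measurable_H1_energy u : H1 u ->
  measurable_fun setT (fun x => grad2 u x + u x ^+ 2).
Proof.
move=> uH; apply: measurable_funD; first exact: measurable_grad2.
by apply: measurable_funX; exact: H1_measurable.
Qed.

Lemma wpartial_le_H1_energy u i : H1 u ->
  (\int[mu]_x (wpartial i u x ^+ 2)%:E <= H1_energy u)%E.
Proof.
move=> uH; apply: ge0_le_integral => //.
- by move=> x _; rewrite lee_fin sqr_ge0.
- apply/measurable_EFinP; apply: measurable_funX.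
  by have [h _] := wpartialP i uH; exact: Lfun_measurable h.
- by apply/measurable_EFinP; exact: measurable_H1_energy.
move=> x _; rewrite lee_fin /grad2 (bigD1 i)//= -addrA lerDl.
by rewrite addr_ge0 ?sqr_ge0// sumr_ge0// => j _; rewrite sqr_ge0.
Qed.

Lemma sqr_le_H1_energy u : H1 u ->
  (\int[mu]_x (u x ^+ 2)%:E <= H1_energy u)%E.
Proof.
move=> uH; apply: ge0_le_integral => //.
- by move=> x _; rewrite lee_fin sqr_ge0.
- by apply/measurable_EFinP; apply: measurable_funX; exact: H1_measurable.
- by apply/measurable_EFinP; exact: measurable_H1_energy.
by move=> x _; rewrite lee_fin lerDr grad2_ge0.
Qed.

Lemma H1_energyZ u c : H1 u ->
  (H1_energy (fun x => c * u x)%R = (c ^+ 2)%:E * H1_energy u)%E.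
Proof.
move=> uH; rewrite /H1_energy -ge0_integralZl_EFin ?sqr_ge0//; last 2 first.
- by move=> x _; rewrite lee_fin addr_ge0 ?grad2_ge0 ?sqr_ge0.
- by apply/measurable_EFinP; exact: measurable_H1_energy.
apply: ae_eq_integral => //.
- by apply/measurable_EFinP; exact: (measurable_H1_energy (H1Z c uH)).
- by apply: measurable_funeM; apply/measurable_EFinP; exact: measurable_H1_energy.
by apply: filterS (grad2Z c uH) => x -> _; rewrite -EFinM exprMn mulrDr.
Qed.

(* Move from [0] to [z] one coordinate at a time; [(p - r)^2 <= 2 (p - q)^2 +
   2 (q - r)^2] costs a constant factor at each step. *)
Lemma integral_diff_cube u (h : R) (z : E) : H1 u -> (H1_energy u <= 1)%E ->
  (forall i, 0 <= z ord0 i <= h) ->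
  (\int[mu]_x ((u (x + z)%R - u x) ^+ 2)%:E <= (4 ^+ n * h ^+ 2)%:E)%E.
Proof.
move=> uH uE zh.
have u2 := H1_Lfun2 uH; have mu_ := H1_measurable uH.
pose Z k : E := \sum_(j < n | (j < k)%N) z ord0 j *: delta_mx 0 j.
have h0 : (0 < n)%N -> 0 <= h.
  by move=> n0; have /andP[a b] := zh (Ordinal n0); rewrite (le_trans a).
suff H k : (k <= n)%N ->
  (\int[mu]_x ((u (x + Z k)%R - u x) ^+ 2)%:E <= (4 ^+ k * h ^+ 2)%:E)%E.
  have := H n (leqnn n); rewrite (_ : Z n = z)// [RHS]row_sum_delta.
  by apply: eq_bigl => j; rewrite ltn_ord.
elim: k => [_|k IH kn].
  rewrite /Z big_pred0// expr0 mul1r.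
  under eq_integral do rewrite addr0 subrr expr0n/=.
  by rewrite integral0 lee_fin sqr_ge0.
pose i := Ordinal kn.
have ZS : Z k.+1 = z ord0 i *: delta_mx 0 i + Z k.
  rewrite /Z (bigD1 i)//=; congr (_ + _); apply: eq_bigl => j.
  by rewrite ltnS leq_eqVlt -(inj_eq val_inj) /=; case: ltngtP.
have [g2 ug] := wpartialP i uH.
have /andP[zi0 zih] := zh i.
have m1 y : measurable_fun setT (fun x : E => u (x + y)).
  exact: (measurableT_comp mu_ (measurable_shift y)).
have mm y : measurable_fun setT (fun x : E => ((u (x + y) - u x) ^+ 2)%:E).
  apply/measurable_EFinP; apply: (measurable_funX (f := fun x : E => u (x + y) - u x)).
  exact: measurable_funB.
apply: (@le_trans _ _ (2%:E * \int[mu]_x ((u (x + Z k + z ord0 i *: delta_mx 0 i)%R - u (x + Z k)%R) ^+ 2)%:E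
   + 2%:E * \int[mu]_x ((u (x + Z k)%R - u x) ^+ 2)%:E)%E).
  have mm2 : measurable_fun setT (fun x : E => ((u (x + Z k + z ord0 i *: delta_mx 0 i)%R - u (x + Z k)%R) ^+ 2)%:E).
    exact: (measurableT_comp (mm (z ord0 i *: delta_mx 0 i)) (measurable_shift (Z k))).
  rewrite -!ge0_integralZl_EFin//; last 2 first.
  - by move=> x _; rewrite lee_fin sqr_ge0.
  - by move=> x _; rewrite lee_fin sqr_ge0.
  rewrite -ge0_integralD//; last 4 first.
  - by move=> x _; rewrite -EFinM lee_fin mulr_ge0 ?sqr_ge0.
  - exact: measurable_funeM.
  - by move=> x _; rewrite -EFinM lee_fin mulr_ge0 ?sqr_ge0.
  - exact: measurable_funeM.
  apply: ge0_le_integral => //.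
  - by move=> x _; rewrite lee_fin sqr_ge0.
  - by apply: emeasurable_funD; exact: measurable_funeM.
  move=> x _; rewrite -!EFinM -EFinD lee_fin ZS (addrC _ (Z k)) addrA.
  set p := u (x + Z k + _); set q := u (x + Z k); set r := u x.
  have := sqr_ge0 (p - q - (q - r)); nra.
apply: (@le_trans _ _ (2%:E * (h ^+ 2)%:E + 2%:E * (4 ^+ k * h ^+ 2)%:E)%E).
  apply: leeD; apply: lee_wpmul2l => //; last exact: (IH (ltnW kn)).
  rewrite (ge0_integral_shift (Z k) (f := fun x => ((u (x + z ord0 i *: delta_mx 0 i) - u x) ^+ 2)%:E))//; last first.
    by move=> x; rewrite lee_fin sqr_ge0.
  apply: (le_trans (weak_partial_diff zi0 u2 g2 ug)).
  apply: (@le_trans _ _ ((z ord0 i ^+ 2)%:E * 1)%E).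
    apply: lee_wpmul2l; first by rewrite lee_fin sqr_ge0.
    exact: le_trans (wpartial_le_H1_energy i uH) uE.
  by rewrite mule1 lee_fin lerXn2r ?nnegrE// (le_trans zi0).
rewrite -!EFinM -EFinD lee_fin [4 ^+ k.+1]exprS.
(* Hence [2 + 2 * 4^k <= 4^(k+1)]. *)
have a1 : 1 <= (4 : R) ^+ k by rewrite exprn_ege1// ler1n.
have : 0 <= (4 ^+ k - 1) * h ^+ 2 by rewrite mulr_ge0 ?sqr_ge0// subr_ge0.
set a := 4 ^+ k; set b := h ^+ 2; lra.
Qed.

End gradient.

(** * Subcritical Sobolev inequality *)

Section sobolev_step.
Context {R : realType} (n : nat).
Notation E := 'rV[R]_n.
Notation mu := (@lebesgue_rV R n).
Implicit Types (u : E -> R).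

Definition Lpow (q : R) u : \bar R := (\int[mu]_x (`|u x| `^ q)%:E)%E.

(** The embedding of H^1 into L^q, stated on the unit ball so that the induction on [q] carries a
    single constant; homogeneity restores the general inequality in [sobolev_subcritical]. *)
Definition Lpow_bounded (q : R) := exists2 C : R, 0 < C &
  forall u, H1 u -> (H1_energy u <= 1)%E -> (Lpow q u <= C%:E)%E.

Lemma measurable_Lpow q u : measurable_fun setT u -> measurable_fun setT (fun x => `|u x| `^ q).
Proof.
move=> mu_; apply: (@measurableT_comp _ _ _ _ _ _ (@powR R ^~ q) _ (fun x : E => `|u x|)).
  exact: measurable_powR.
exact: measurableT_comp.
Qed.

Lemma Lpow_bounded2 : Lpow_bounded 2.
Proof.
exists 1 => // u uH uE; apply: le_trans uE; apply: le_trans (sqr_le_H1_energy uH).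
rewrite /Lpow (eq_integral (fun x => (u x ^+ 2)%:E))// => x _.
by rewrite powR_mulrn// real_normK ?num_real.
Qed.

Let cube (h : R) : set E := obox (const_mx 0) (const_mx h).

Let measurable_cube h : measurable (cube h).
Proof. exact: measurable_obox. Qed.

Let mu_cube h : 0 <= h -> mu (cube h) = (h ^+ n)%:E.
Proof.
move=> h0; rewrite lebesgue_rV_obox => [|i]; last by rewrite !mxE.
by under eq_bigr do rewrite !mxE subr0; rewrite prodr_const card_ord.
Qed.

(** The mean square oscillation of [u] near [x] at scale [h], not divided by the volume [h^n] of the
    cube. *)
Definition osc (h : R) u (x : E) : \bar R :=
  (\int[mu]_z ((u (z + x)%R - u x) ^+ 2 * \1_(obox (const_mx 0) (const_mx h)) z)%:E)%E.

Lemma osc_ge0 h u x : (0 <= osc h u x)%E.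
Proof. by apply: integral_ge0 => z _; rewrite lee_fin mulr_ge0 ?sqr_ge0. Qed.

Let measurable_osc_kernel h u : measurable_fun setT u ->
  measurable_fun setT (fun z : E * E => ((u (z.2 + z.1)%R - u z.1) ^+ 2 * \1_(cube h) z.2)%:E).
Proof.
move=> mu_; apply/measurable_EFinP; apply: measurable_funM.
  apply: (measurable_funX (f := fun z : E * E => u (z.2 + z.1) - u z.1)).
  apply: measurable_funB; last exact: measurableT_comp.
  have -> : (fun z : E * E => u (z.2 + z.1)) = u \o (fun z : E * E => z.1 + z.2).
    by apply/funext => z /=; rewrite addrC.
  exact: (measurableT_comp mu_ (@measurable_addrV _ _)).
have m1 : measurable_fun setT (\1_(cube h) : E -> R) by exact: measurable_indic.
exact: (measurableT_comp m1 measurable_snd).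
Qed.

Let osc_kernel_ge0 h u (z : E * E) :
  (0 <= ((u (z.2 + z.1)%R - u z.1) ^+ 2 * \1_(cube h) z.2)%:E)%E.
Proof. by rewrite lee_fin mulr_ge0 ?sqr_ge0. Qed.

Lemma measurable_osc h u : measurable_fun setT u -> measurable_fun setT (osc h u).
Proof.
move=> mu_.
exact: (@measurable_fun_fubini_tonelli_F _ _ _ _ _ mu _ (measurable_osc_kernel h mu_) (osc_kernel_ge0 h u)).
Qed.

(** By Tonelli the shift [z] can be fixed first, and [integral_diff_cube] is uniform over the cube.
    The factor [h^2] is the gain that later makes a series over dyadic scales converge. *)
Lemma integral_osc h u : 0 < h -> H1 u -> (H1_energy u <= 1)%E ->
  (\int[mu]_x osc h u x <= (h ^+ n * (4 ^+ n * h ^+ 2))%:E)%E.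
Proof.
move=> h0 uH uE; have mu_ := H1_measurable uH.
have mk := measurable_osc_kernel h mu_; have k0 := osc_kernel_ge0 h u.
rewrite /osc (fubini_tonelli _ mk k0) /=.
have m1 : measurable_fun setT (\1_(cube h) : E -> R) by exact: measurable_indic.
apply: (@le_trans _ _ (\int[mu]_z ((4 ^+ n * h ^+ 2)%:E * (\1_(cube h) z)%:E))%E).
  apply: ge0_le_integral => //.
  - by move=> z _; apply: integral_ge0 => x _; exact: (k0 (x, z)).
  - exact: (@measurable_fun_fubini_tonelli_G _ _ _ _ _ mu _ mk k0).
  - by apply: measurable_funeM; exact/measurable_EFinP.
  move=> z _; rewrite -/(cube h) indicE; have [|] := boolP (z \in cube h); last first.
    by rewrite mule0 integral0_eq// => x _; rewrite mulr0.
  rewrite inE => zh; rewrite mule1.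
  under eq_integral => x _ do rewrite mulr1 (addrC z x).
  apply: integral_diff_cube => // i.
  by have := zh i; rewrite !mxE => /andP[/ltW -> /ltW ->].
rewrite ge0_integralZl_EFin//; last 2 first.
- exact/measurable_EFinP.
- by rewrite mulr_ge0 ?sqr_ge0// exprn_ge0.
rewrite integral_indic// setIT [X in (_ * X)%E](_ : _ = (h ^+ n)%:E).
  by rewrite -EFinM mulrC.
exact: (mu_cube (ltW h0)).
Qed.

(* For each [z], either [2 |u (x + z)| >= |u x|] or [2 |u (x + z) - u x| >= |u x|],
   so [1 <= (2 |u (x + z)| / |u x|)^q + 4 (u (x + z) - u x)^2 / (u x)^2]; integrate
   over [z] in a cube on which the first term contributes at most half. *)
Lemma sqr_le_osc h u x q C : 0 < h -> 0 < q -> 0 < C -> measurable_fun setT u ->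
  (Lpow q u <= C%:E)%E -> 2 * (2 `^ q * C) <= h ^+ n * `|u x| `^ q ->
  ((u x ^+ 2)%:E <= (8 / h ^+ n)%:E * osc h u x)%E.
Proof.
move=> h0 q0 C0 mu_ uC hx.
have hn0 : 0 < h ^+ n by rewrite exprn_gt0.
set t := `|u x|.
have tq0 : 0 < t `^ q.
  rewrite -(pmulr_rgt0 _ hn0); apply: lt_le_trans hx.
  by rewrite !mulr_gt0// powR_gt0.
have t0 : 0 < t by apply: (gt0_powR q0) => //; exact: normr_ge0.
have [oscoo|] := ltP (osc h u x) +oo%E; last first.
  by rewrite leye_eq => /eqP ->; rewrite gt0_muley ?leey// lte_fin divr_gt0.
have oE : osc h u x = (fine (osc h u x))%:E by rewrite fineK// ge0_fin_numE// osc_ge0.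
set w := fine (osc h u x) in oE.
have m1 : measurable_fun setT (\1_(cube h) : E -> R) by exact: measurable_indic.
have mux : measurable_fun setT (fun z : E => u (z + x)).
  exact: (measurableT_comp mu_ (measurable_shift x)).
have mq : measurable_fun setT (fun z : E => `|u (z + x)| `^ q) by exact: measurable_Lpow.
have md : measurable_fun setT (fun z : E => (u (z + x) - u x) ^+ 2 * \1_(cube h) z).
  apply: measurable_funM => //.
  apply: (measurable_funX (f := fun z : E => u (z + x) - u x)).
  exact: measurable_funB.
have : ((h ^+ n)%:E <= ((2 / t) `^ q * C + 4 / t ^+ 2 * w)%:E)%E.
  have -> : ((h ^+ n)%:E = \int[mu]_z (\1_(cube h) z)%:E)%E.
    by rewrite integral_indic// setIT; exact/esym/(mu_cube (ltW h0)).
  apply: (@le_trans _ _ (((2 / t) `^ q)%:E * \int[mu]_z (`|u (z + x)%R| `^ q)%:E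
     + (4 / t ^+ 2)%:E * osc h u x)%E).
    have e1 : (((2 / t) `^ q)%:E * \int[mu]_z (`|u (z + x)%R| `^ q)%:E =
        \int[mu]_z (((2 / t) `^ q)%:E * (`|u (z + x)%R| `^ q)%:E))%E.
      by rewrite ge0_integralZl_EFin ?powR_ge0//; exact/measurable_EFinP.
    have e2 : ((4 / t ^+ 2)%:E * osc h u x = \int[mu]_z ((4 / t ^+ 2)%:E *
        ((u (z + x)%R - u x) ^+ 2 * \1_(cube h) z)%:E))%E.
      rewrite ge0_integralZl_EFin ?divr_ge0 ?sqr_ge0//; last exact/measurable_EFinP.
      by move=> z _; rewrite lee_fin mulr_ge0 ?sqr_ge0.
    have q4 z : (0 <= (4 / t ^+ 2)%:E * ((u (z + x)%R - u x) ^+ 2 * \1_(cube h) z)%:E)%E.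
      apply: mule_ge0; rewrite lee_fin; last by rewrite mulr_ge0 ?sqr_ge0.
      by rewrite divr_ge0// sqr_ge0.
    rewrite e1 e2 -ge0_integralD//; [|idtac..];
      try by [move=> z _; rewrite -EFinM lee_fin mulr_ge0 ?powR_ge0
             |apply: measurable_funeM; exact/measurable_EFinP
             |move=> z _; exact: q4].
    apply: ge0_le_integral => //.
    - exact/measurable_EFinP.
    - by apply: emeasurable_funD; apply: measurable_funeM; exact/measurable_EFinP.
    move=> z _; rewrite -!EFinM -EFinD lee_fin indicE; case: (z \in cube h) => /=; last first.
      by rewrite !mulr0 addr0 mulr_ge0 ?powR_ge0.
    rewrite mulr1 -powRM ?divr_ge0//; last by rewrite ltW.
    have [tz|tz] := leP (t / 2) `|u (z + x)|.
      rewrite -[X in X <= _]addr0 lerD//; last by rewrite mulr_ge0 ?divr_ge0 ?sqr_ge0.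
      rewrite [X in X <= _](_ : _ = 1 `^ q); last by rewrite powR1.
      have ut0 : 0 <= 2 / t * `|u (z + x)| by rewrite mulr_ge0// divr_ge0// ltW.
      apply: ge0_ler_powR; rewrite ?nnegrE ?(ltW q0)//.
      by rewrite mulrAC ler_pdivlMr// mul1r; lra.
    rewrite -[X in X <= _]add0r lerD ?powR_ge0// mulrAC ler_pdivlMr ?exprn_gt0// mul1r.
    rewrite -[(u (z + x) - u x) ^+ 2]real_normK ?num_real//.
    have : t / 2 <= `|u (z + x) - u x|.
      by have := lerB_dist (u x) (u (z + x)); rewrite distrC -/t; lra.
    by set d := `|_|; nra.
  rewrite EFinD; apply: leeD; last by rewrite oE -EFinM.
  rewrite EFinM; apply: lee_wpmul2l; first by rewrite lee_fin powR_ge0.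
  rewrite (ge0_integral_shift x (f := fun z => (`|u z| `^ q)%:E))//.
  by apply/measurable_EFinP; exact: measurable_Lpow.
rewrite lee_fin oE -EFinM lee_fin => H.
have H1 : (2 / t) `^ q * C <= h ^+ n / 2.
  rewrite powRM ?invr_ge0 ?(ltW t0)// -powR_inv1 ?(ltW t0)// powRAC powR_inv1 ?powR_ge0//.
  rewrite mulrAC ler_pdivrMr// mulrAC ler_pdivlMr//; lra.
have H2 : h ^+ n / 2 <= 4 / t ^+ 2 * w by lra.
rewrite -real_normK ?num_real// -/t.
move: H2; rewrite mulrAC ler_pdivlMr ?exprn_gt0// => H2.
rewrite mulrAC ler_pdivlMr//; lra.
Qed.

End sobolev_step.

Section sobolev.
Context {R : realType} (n : nat).
Notation E := 'rV[R]_n.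
Notation mu := (@lebesgue_rV R n).
Implicit Types (u : E -> R).

Lemma powR_exprn (x q : R) k : 0 <= x -> (x ^+ k) `^ q = (x `^ q) ^+ k.
Proof.
by move=> x0; rewrite -!powR_mulrn ?powR_ge0// -!powRrM mulrC.
Qed.

Lemma exists_exprn_gt (s y : R) : 1 < s -> exists k : nat, y < s ^+ k.
Proof.
move=> s1; have h k : 1 + k%:R * (s - 1) <= s ^+ k.
  elim: k => [|k IH]; first by rewrite mul0r addr0 expr0.
  rewrite exprS -natr1.
  have : 0 <= k%:R * (s - 1) by rewrite mulr_ge0// subr_ge0 ltW.
  have s0 : 0 <= s by lra.
  have := ler_wpM2l s0 IH; have := sqr_ge0 (s - 1); have := ler0n R k.
  set a := k%:R; set b := s ^+ k; nra.
exists (Num.truncn (`|y| / (s - 1))).+1.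
apply: lt_le_trans (h _); have := truncnS_gt (`|y| / (s - 1)).
rewrite ltr_pdivrMr ?subr_gt0// => H.
by apply: (le_lt_trans (ler_norm y)); lra.
Qed.

Lemma sum_exprn_le (rho : R) m : 0 <= rho < 1 -> \sum_(0 <= k < m) rho ^+ k <= (1 - rho)^-1.
Proof.
move=> /andP[r0 r1]; have d : 0 < 1 - rho by rewrite subr_gt0.
rewrite -[leRHS]div1r ler_pdivlMr// big_mkord.
have := subrX1 rho m; have : 0 <= rho ^+ m by rewrite exprn_ge0.
set S := \sum_(_ < _) _; set a := rho ^+ m; lra.
Qed.

Lemma dyadic_level (T s t : R) : 0 < T -> 1 < s -> T <= t ->
  exists k, T * s ^+ k <= t < T * s ^+ k.+1.
Proof.
move=> T0 s1 Tt.
have ex : exists k, t < T * s ^+ k.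
  have [k hk] := exists_exprn_gt (t / T) s1.
  by exists k; rewrite mulrC -ltr_pdivrMr.
case: (ex_minnP ex) => -[|k] hk hmin.
  by move: hk; rewrite expr0 mulr1 ltNge Tt.
exists k; rewrite hk andbT leNgt; apply/negP => /hmin.
by rewrite ltnn.
Qed.

(* Decompose [{|u| >= T}] into the levels [T s^k <= |u| < T s^(k+1)] with
   [s = 2^(n/q)], and apply [sqr_le_osc] on the k-th one with cubes of side
   [h = 2^-k], the size for which its hypothesis is scale invariant. The series
   has ratio [s^(r-2) / 4], which is less than 1 iff [r < 2 + 2 q / n]. *)
Lemma Lpow_step (q r : R) : (0 < n)%N -> 0 < q -> 2 <= r -> r < 2 + 2 * q / n%:R ->
  @Lpow_bounded R n q -> @Lpow_bounded R n r.
Proof.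
move=> n0 q0 r2 rq [C C0 HC].
have n0R : 0 < n%:R :> R by rewrite ltr0n.
set be := r - 2.
have be0 : 0 <= be by rewrite subr_ge0.
(* The value of [|u x|] from which the hypothesis of [sqr_le_osc] holds for the unit cube. *)
pose T := (2 * (2 `^ q * C)) `^ q^-1.
have TC0 : 0 < 2 * (2 `^ q * C) by rewrite !mulr_gt0// powR_gt0.
have T0 : 0 < T by rewrite powR_gt0.
have Tq : T `^ q = 2 * (2 `^ q * C).
  by rewrite /T -powRrM mulVf ?gt_eqF// powRr1// ltW.
pose s := 2 `^ (n%:R / q) : R.
have nq0 : 0 < n%:R / q by rewrite divr_gt0.
have s1 : 1 < s.
  have -> : 1 = 1 `^ (n%:R / q) :> R by rewrite powR1.
  by apply: gt0_ltr_powR; rewrite ?nnegrE// ltr1n.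
have s0 : 0 < s by lra.
have sq : s `^ q = 2 ^+ n by rewrite /s -powRrM mulfVK ?gt_eqF// powR_mulrn.
pose rho := s `^ be / 4.
have rho0 : 0 <= rho by rewrite divr_ge0// powR_ge0.
have rho1 : rho < 1.
  rewrite ltr_pdivrMr// mul1r /s -powRrM.
  have -> : (4 : R) = 2 `^ 2 by rewrite powR_mulrn// expr2; lra.
  rewrite /powR pnatr_eq0/= ltr_expR ltr_pM2r; last by rewrite ln_gt0// ltr1n.
  rewrite mulrAC ltr_pdivrMr// -ltr_pdivlMl// mulrC [_ * q]mulrC (mulrC q) /be; lra.
pose h k : R := 2^-1 ^+ k.
have h0 k : 0 < h k by rewrite exprn_gt0// invr_gt0.
(* On the k-th level [|u|^r = |u|^be u^2]: the first factor is at most [(T s^(k+1))^be], and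
   [sqr_le_osc] bounds the second by [8 / h^n] times the oscillation. *)
pose a k := (T * s ^+ k.+1) `^ be * (8 / h k ^+ n).
have a0 k : 0 <= a k by rewrite mulr_ge0 ?powR_ge0// divr_ge0// exprn_ge0// ltW.
pose c := (T * s) `^ be * 8 * 4 ^+ n.
have c0 : 0 <= c by rewrite !mulr_ge0 ?powR_ge0 ?exprn_ge0.
(* The volume [h^n] cancels, and [h^2 = 4^-k] produces the 4 in [rho]. *)
have acE k : a k * (h k ^+ n * (4 ^+ n * h k ^+ 2)) = c * rho ^+ k.
  rewrite /a /c /rho (exprS s k) (mulrA T) [(T * s * _) `^ be]powRM ?mulr_ge0 ?exprn_ge0 ?(ltW T0) ?(ltW s0)//.
  rewrite powR_exprn ?(ltW s0)// expr_div_n.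
  have -> : h k ^+ 2 = (4 ^+ k)^-1.
    by rewrite /h exprAC expr2 -invfM exprVn; congr (_ ^+ _)^-1; lra.
  field; rewrite !expf_eq0 /= pnatr_eq0 andbF /= gt_eqF ?andbF//.
exists (T `^ be + c / (1 - rho)).
  by rewrite ltr_pwDl ?powR_gt0// divr_ge0// subr_ge0 ltW.
move=> u uH uE; have mu_ := H1_measurable uH.
have uC := HC _ uH uE.
pose W k x := ((a k)%:E * osc (h k) u x)%E.
have W0 k x : (0 <= W k x)%E by rewrite mule_ge0 ?lee_fin// osc_ge0.
have mW k : measurable_fun setT (W k) by apply: measurable_funeM; exact: measurable_osc.
have pw x : ((`|u x| `^ r)%:E <= (T `^ be * u x ^+ 2)%:E + \sum_(k <oo) W k x)%E.
  have rE : `|u x| `^ r = `|u x| `^ be * u x ^+ 2.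
    rewrite -[u x ^+ 2]real_normK ?num_real// -powR_mulrn// -powRD ?subrK//.
    by rewrite gt_eqF// (lt_le_trans _ r2).
  have [uT|Tu] := ltP `|u x| T.
    rewrite -[leLHS]adde0; apply: leeD; last by apply: nneseries_ge0 => k _ _; exact: W0.
    rewrite rE lee_fin ler_wpM2r ?sqr_ge0//.
    by apply: ge0_ler_powR => //; rewrite ?nnegrE// ltW.
  have [k /andP[k1 k2]] := dyadic_level T0 s1 Tu.
  rewrite -[leLHS]add0e; apply: leeD; first by rewrite lee_fin mulr_ge0 ?powR_ge0 ?sqr_ge0.
  apply: (@le_trans _ _ (W k x)); last first.
    apply: (@le_trans _ _ (\sum_(0 <= i < k.+1) W i x)%E).
      by rewrite big_nat_recr//= leeDr// sume_ge0.
    by apply: nneseries_lim_ge => i _ _; exact: W0.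
  have -> : W k x = (((T * s ^+ k.+1) `^ be)%:E * ((8 / h k ^+ n)%:E * osc (h k) u x))%E.
    by rewrite muleA -EFinM.
  rewrite rE EFinM.
  apply: (@le_trans _ _ (((T * s ^+ k.+1) `^ be)%:E * (u x ^+ 2)%:E)%E).
    apply: lee_wpmul2r; first by rewrite lee_fin sqr_ge0.
    rewrite lee_fin; apply: ge0_ler_powR => //; rewrite ?nnegrE// ?(ltW k2)//.
    by rewrite mulr_ge0 ?exprn_ge0// ltW.
  apply: lee_wpmul2l; first by rewrite lee_fin powR_ge0.
  apply: (sqr_le_osc (h0 k) q0 C0 mu_ uC).
  apply: (@le_trans _ _ (h k ^+ n * (T * s ^+ k) `^ q)).
    rewrite powRM ?exprn_ge0 ?(ltW T0) ?(ltW s0)// powR_exprn ?(ltW s0)// sq Tq.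
    have hk : h k ^+ n * (2 ^+ n) ^+ k = 1.
      by rewrite /h -!exprM (mulnC n) -exprMn mulVf ?pnatr_eq0// expr1n.
    by rewrite [leRHS]mulrCA hk mulr1.
  rewrite ler_wpM2l ?exprn_ge0 ?(ltW (h0 k))//.
  by apply: ge0_ler_powR; rewrite ?nnegrE ?(ltW q0)// mulr_ge0 ?exprn_ge0// ltW.
have mu2 : measurable_fun setT (fun x => (T `^ be * u x ^+ 2)%:E).
  by apply/measurable_EFinP; apply: measurable_funM => //; exact: measurable_funX.
have mS : measurable_fun setT (fun x => \sum_(k <oo) W k x)%E.
  by apply: ge0_emeasurable_sum.
apply: (@le_trans _ _ (\int[mu]_x ((T `^ be * u x ^+ 2)%:E + \sum_(k <oo) W k x))%E).
  apply: ge0_le_integral => //.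
  - by apply/measurable_EFinP; exact: measurable_Lpow.
  - exact: emeasurable_funD.
rewrite ge0_integralD//; last 2 first.
- by move=> x _; rewrite lee_fin mulr_ge0 ?powR_ge0 ?sqr_ge0.
- by move=> x _; apply: nneseries_ge0 => k _ _; exact: W0.
rewrite EFinD; apply: leeD.
  under eq_integral do rewrite EFinM.
  rewrite ge0_integralZl_EFin ?powR_ge0//; last 2 first.
  - by move=> x _; rewrite lee_fin sqr_ge0.
  - by apply/measurable_EFinP; exact: measurable_funX.
  rewrite -[leRHS]mule1; apply: lee_wpmul2l; first by rewrite lee_fin powR_ge0.
  exact: le_trans (sqr_le_H1_energy uH) uE.
rewrite integral_nneseries//.
apply: lime_le; first by apply: is_cvg_nneseries => k _ _; exact: integral_ge0.
apply: nearW => m.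
apply: (@le_trans _ _ (\sum_(0 <= k < m) (c * rho ^+ k)%:E)%E).
  apply: lee_sum => k _.
  rewrite /W ge0_integralZl_EFin//; last 2 first.
  - by move=> x _; exact: osc_ge0.
  - exact: measurable_osc.
  rewrite -acE (EFinM (a k)); apply: lee_wpmul2l; first by rewrite lee_fin.
  exact: integral_osc.
rewrite sumEFin lee_fin -mulr_sumr ler_wpM2l//.
by apply: sum_exprn_le; rewrite rho0.
Qed.

(* Iterating [q -> 2 + 2 q / n] from [q = 2] increases to [2 n / (n - 2)]; below
   [r] each step can be taken of a fixed length [d]. *)
Lemma Lpow_bounded_subcritical (r : R) : (2 <= n)%N -> 2 <= r ->
  r * (n%:R - 2) < 2 * n%:R -> @Lpow_bounded R n r.
Proof.
move=> n2 r2 rn.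
have n0R : 2 <= n%:R :> R by rewrite (ler_nat R 2 n).
have r0 : 0 < r by lra.
have n0 : 0 < n%:R :> R by lra.
(* Replacing [q] by [2 + 2 q / n] gains [2 - q (n - 2) / n], which is at least
   [2 - r (n - 2) / n = 2 d] as long as [q <= r]. Taking half of it keeps the inequality required by
   [Lpow_step] strict. *)
pose d := (2 * n%:R - r * (n%:R - 2)) / (2 * n%:R).
have d0 : 0 < d by rewrite divr_gt0 ?mulr_gt0// subr_gt0.
suff H k : @Lpow_bounded R n (Num.min r (2 + k%:R * d)).
  have := H (Num.truncn (r / d)).+1; rewrite min_l//.
  have := truncnS_gt (r / d); rewrite ltr_pdivrMr//; lra.
elim: k => [|k IH].
  by rewrite mul0r addr0 min_r//; exact: Lpow_bounded2.
set q := Num.min _ _ in IH.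
have [rk|rk] := leP r (2 + k%:R * d).
  rewrite min_l; first by move: IH; rewrite /q min_l.
  by apply: (le_trans rk); rewrite lerD2l ler_pM2r// ler_nat.
have qE : q = 2 + k%:R * d by rewrite /q min_r// ltW.
have k0 : 0 <= k%:R * d by rewrite mulr_ge0// ltW.
apply: (Lpow_step _ _ _ _ IH).
- exact: leq_trans n2.
- rewrite qE; lra.
- rewrite le_min r2 /= -natr1; lra.
apply: (@le_lt_trans _ _ (q + d)).
  by rewrite ge_min; apply/orP; right; rewrite qE -natr1; lra.
have XY : q * (n%:R - 2) / n%:R <= r * (n%:R - 2) / n%:R.
  by rewrite ler_pM2r ?invr_gt0// ler_wpM2r ?subr_ge0// qE ltW.
have Y2 : r * (n%:R - 2) / n%:R < 2 by rewrite ltr_pdivrMr.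
have -> : 2 * q / n%:R = q - q * (n%:R - 2) / n%:R by field; rewrite gt_eqF.
have -> : d = 1 - r * (n%:R - 2) / n%:R / 2 by rewrite /d; field; rewrite gt_eqF.
lra.
Qed.

Lemma LpowZ r u c : 0 <= c -> measurable_fun setT u ->
  (Lpow r (fun x => c * u x)%R = (c `^ r)%:E * Lpow r u)%E.
Proof.
move=> c0 mu_; rewrite /Lpow -ge0_integralZl_EFin ?powR_ge0//; last first.
  by apply/measurable_EFinP; exact: measurable_Lpow.
by apply: eq_integral => x _; rewrite -EFinM normrM (ger0_norm c0) powRM.
Qed.

(** Apply the unit ball estimate to [u / m]. An upper bound [m] of the norm takes the place of the
    norm because [m > 0] can be divided by even when [u] vanishes. *)
Lemma sobolev_subcritical (r : R) : (2 <= n)%N -> 2 <= r ->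
  r * (n%:R - 2) < 2 * n%:R -> exists2 C : R, 0 < C &
  forall u m, H1 u -> 0 < m -> (H1_energy u <= (m ^+ 2)%:E)%E ->
    (Lpow r u <= (C * m `^ r)%:E)%E.
Proof.
move=> n2 r2 rn; have [C C0 HC] := Lpow_bounded_subcritical n2 r2 rn.
exists C => // u m uH m0 uE.
pose v x := m^-1 * u x.
have vH : H1 v by exact: H1Z.
have -> : u = (fun x => m * v x) by apply/funext => x; rewrite /v mulVKf// gt_eqF.
rewrite LpowZ ?(ltW m0)//; last exact: H1_measurable.
rewrite mulrC EFinM; apply: lee_wpmul2l; first by rewrite lee_fin powR_ge0.
apply: HC => //; rewrite H1_energyZ//.
apply: (@le_trans _ _ ((m^-1 ^+ 2)%:E * (m ^+ 2)%:E)%E).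
  by apply: lee_wpmul2l; rewrite ?lee_fin ?sqr_ge0.
by rewrite -EFinM -exprMn mulVf ?gt_eqF// expr1n.
Qed.

Lemma H1_energy_fin u : H1 u -> (H1_energy u < +oo)%E.
Proof.
move=> uH.
have [mu_ u2] := (Lfun2P mu u).1 (H1_Lfun2 uH).
have g2 i : (\int[mu]_x (wpartial i u x ^+ 2)%:E < +oo)%E.
  by have [/Lfun2P[]] := wpartialP i uH.
have mg i : measurable_fun setT (wpartial i u).
  by have [/Lfun2P[]] := wpartialP i uH.
rewrite /H1_energy; under eq_integral do rewrite EFinD.
rewrite ge0_integralD//; last 4 first.
- by move=> x _; rewrite lee_fin grad2_ge0.
- by apply/measurable_EFinP; exact: measurable_grad2.
- by move=> x _; rewrite lee_fin sqr_ge0.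
- by apply/measurable_EFinP; exact: measurable_funX.
apply: lte_add_pinfty => //.
under eq_integral do rewrite /grad2 -sumEFin.
rewrite ge0_integral_sum//.
- by apply: lte_sum_pinfty => i _; exact: g2.
- by move=> i; apply/measurable_EFinP; exact: measurable_funX.
- by move=> i x _; rewrite lee_fin sqr_ge0.
Qed.

Lemma Lpow_fin (r : R) u : (2 <= n)%N -> 2 <= r -> r * (n%:R - 2) < 2 * n%:R ->
  H1 u -> (Lpow r u < +oo)%E.
Proof.
move=> n2 r2 rn uH; have [C C0 HC] := sobolev_subcritical n2 r2 rn.
set e := fine (H1_energy u).
have E0 : (0 <= H1_energy u)%E.
  by apply: integral_ge0 => x _; rewrite lee_fin addr_ge0 ?grad2_ge0 ?sqr_ge0.
have eE : H1_energy u = e%:E by rewrite fineK// ge0_fin_numE// H1_energy_fin.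
have e0 : 0 <= e by rewrite fine_ge0.
(* [m = e + 1] is positive and [e <= m^2]. *)
apply: (@le_lt_trans _ _ (C * (e + 1) `^ r)%:E); last by rewrite ltry.
apply: HC => //; first by rewrite ltr_wpDl.
rewrite eE lee_fin; nra.
Qed.

End sobolev.

(** * Energies and Nehari sets *)

Section translate.
Context {R : realType} (n : nat).
Notation E := 'rV[R]_n.
Notation mu := (@lebesgue_rV R n).
Implicit Types (u : E -> R).

Lemma measurable_translate_kernel (a u : E -> R) (Q : set E) :
  measurable_fun setT a -> measurable_fun setT u -> measurable Q ->
  measurable_fun setT (fun z : E * E => (a z.1 * u (z.1 + z.2)%R ^+ 2 * \1_Q z.2)%:E).
Proof.
move=> ma mu_ mQ; apply/measurable_EFinP; apply: measurable_funM.
  apply: measurable_funM; first exact: measurableT_comp.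
  apply: (measurable_funX (f := fun z : E * E => u (z.1 + z.2))).
  exact: (measurableT_comp mu_ (@measurable_addrV _ _)).
have m1 : measurable_fun setT (\1_Q : E -> R) by exact: measurable_indic.
exact: (measurableT_comp m1 measurable_snd).
Qed.

Lemma translate_kernel_ge0 (a u : E -> R) (Q : set E) : (forall x, 0 <= a x) ->
  forall z : E * E, (0 <= (a z.1 * u (z.1 + z.2)%R ^+ 2 * \1_Q z.2)%:E)%E.
Proof.
by move=> a0 z; rewrite lee_fin; apply: mulr_ge0 => //; apply: mulr_ge0 => //; exact: sqr_ge0.
Qed.

(** For fixed [x], integrating [u(x + y)^2] over [y] in the cube gives at most its integral over the
    whole space. The point is that the bound does not depend on the side [k]. *)
Lemma integral_cube_translate (a u : E -> R) (k : nat) :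
  measurable_fun setT a -> measurable_fun setT u -> (forall x, 0 <= a x) ->
  (\int[mu]_y \int[mu]_x (a x * u (x + y)%R ^+ 2 * \1_(obox (const_mx 0) (const_mx k%:R)) y)%:E
   <= \int[mu]_x (a x)%:E * \int[mu]_x (u x ^+ 2)%:E)%E.
Proof.
move=> ma mu_ a0; set Q := obox _ _.
have mQ : measurable Q by exact: measurable_obox.
have mk := measurable_translate_kernel ma mu_ mQ.
have k0 := translate_kernel_ge0 u Q a0.
rewrite -(fubini_tonelli _ mk k0) -ge0_integralZr//; last 3 first.
- exact/measurable_EFinP.
- by move=> x _; rewrite lee_fin.
- by apply: integral_ge0 => x _; rewrite lee_fin sqr_ge0.
have mux y : measurable_fun setT (fun x : E => u (x + y)).
  exact: (measurableT_comp mu_ (measurable_shift y)).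
apply: ge0_le_integral => //.
- by move=> x _; apply: integral_ge0 => y _; exact: (k0 (x, y)).
- exact: (@measurable_fun_fubini_tonelli_F _ _ _ _ _ mu _ mk k0).
- by apply: emeasurable_funM => //; exact/measurable_EFinP.
move=> x _ /=.
apply: (@le_trans _ _ (\int[mu]_y ((a x)%:E * (u (y + x)%R ^+ 2)%:E))%E).
  apply: ge0_le_integral => //.
  - by move=> y _; exact: (k0 (x, y)).
  - have mm : measurable_fun setT (fun y : E => (x, y)) by exact: measurable_pair1.
    exact: (measurableT_comp mk mm).
  - by apply: measurable_funeM; apply/measurable_EFinP; exact: (measurable_funX (f := fun y : E => u (y + x))).
  move=> y _; rewrite -EFinM lee_fin (addrC y x).
  have h1 : \1_Q y <= 1 :> R by rewrite indicE lern1 leq_b1.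
  have h2 : 0 <= a x * u (x + y) ^+ 2 by apply: mulr_ge0 => //; exact: sqr_ge0.
  by rewrite ler_piMr.
rewrite ge0_integralZl_EFin//; last 2 first.
- by move=> y _; rewrite lee_fin sqr_ge0.
- by apply/measurable_EFinP; exact: (measurable_funX (f := fun y : E => u (y + x))).
rewrite (ge0_integral_shift x (f := fun x => (u x ^+ 2)%:E))//.
- by apply/measurable_EFinP; exact: measurable_funX.
- by move=> z; rewrite lee_fin sqr_ge0.
Qed.

(** If the integral exceeded [e] for every [y], averaging over a cube of side [k] would give
    [e k^n <= K] with [K] independent of [k], which fails for large [k] since [n > 0]. *)
Lemma exists_translate_Lfun1 (a u : E -> R) (e : R) : (0 < n)%N -> 0 < e ->
  measurable_fun setT a -> (forall x, 0 <= a x) -> (\int[mu]_x (a x)%:E < +oo)%E ->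
  u \in Lfun mu 2%:E ->
  exists y, (\int[mu]_x (a x * u (x + y)%R ^+ 2)%:E <= e%:E)%E.
Proof.
move=> n0 e0 ma a0 aoo /Lfun2P[mu_ uoo].
apply: contrapT => /forallNP Hn.
set K := (\int[mu]_x (a x)%:E * \int[mu]_x (u x ^+ 2)%:E)%E.
have K0 : (0 <= K)%E.
  by rewrite mule_ge0// integral_ge0// => x _; rewrite lee_fin// sqr_ge0.
have KE : K = (fine K)%:E.
  rewrite fineK// fin_numM// ge0_fin_numE// integral_ge0// => x _; rewrite lee_fin//.
  exact: sqr_ge0.
have bound k : ((e * k%:R ^+ n)%:E <= K)%E.
  have mo := measurable_obox (const_mx 0) (const_mx k%:R : E).
  have m1 : measurable_fun setT (\1_(obox (const_mx 0) (const_mx k%:R)) : E -> R) by exact: measurable_indic.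
  apply: le_trans (integral_cube_translate k ma mu_ a0).
  apply: (@le_trans _ _ (\int[mu]_y (e%:E * (\1_(obox (const_mx 0) (const_mx k%:R)) y)%:E))%E).
    rewrite ge0_integralZl_EFin ?(ltW e0)//; last exact/measurable_EFinP.
    rewrite integral_indic// setIT EFinM; apply: lee_wpmul2l; first by rewrite lee_fin ltW.
    rewrite le_eqVlt; apply/orP; left; apply/eqP; apply/esym.
    apply: (etrans (lebesgue_rV_obox _)) => [i|]; first by rewrite !mxE.
    by under eq_bigr do rewrite !mxE subr0; rewrite prodr_const card_ord.
  have mk := measurable_translate_kernel ma mu_ mo.
  have k0 := translate_kernel_ge0 u (obox (const_mx 0) (const_mx k%:R)) a0.
  apply: ge0_le_integral => //.
  - by move=> y _; rewrite -EFinM lee_fin mulr_ge0// ltW.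
  - by apply: measurable_funeM; exact/measurable_EFinP.
  - exact: (@measurable_fun_fubini_tonelli_G _ _ _ _ _ mu _ mk k0).
  move=> y _; rewrite indicE; case: (y \in _); last first.
    by rewrite mule0 integral_ge0// => x _; rewrite mulr0.
  rewrite mule1; under eq_integral do rewrite mulr1.
  by apply: ltW; rewrite ltNge; apply/negP; exact: Hn.
have := bound (Num.truncn (fine K / e)).+1.
rewrite KE lee_fin; apply/negP; rewrite -ltNge.
have := truncnS_gt (fine K / e); rewrite ltr_pdivrMr// mulrC => /lt_le_trans; apply.
rewrite ler_pM2l// -[leLHS]expr1 ler_weXn2l//.
by rewrite ler1n.
Qed.

(** Truncation: [a <= d + b], where [b] equals [a] on [{a > d}] and 0 elsewhere. The small constant
    [d] costs at most [e / 2] for every translate. The function [b] is integrable because [a = a^(1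
    - n/2) a^(n/2) <= d^(1 - n/2) a^(n/2)] on [{a > d}], the exponent [1 - n/2] being
    nonpositive. *)
Lemma exists_translate (a u : E -> R) (e : R) : (2 <= n)%N -> 0 < e ->
  a \in Lfun mu (n%:R / 2)%:E -> {ae mu, forall x, 0 <= a x} ->
  u \in Lfun mu 2%:E ->
  exists y, (\int[mu]_x (a x * u (x + y)%R ^+ 2)%:E <= e%:E)%E.
Proof.
move=> n2 e0 aL a0 u2; have ma := Lfun_measurable aL.
have [mu_ uoo] := (Lfun2P mu u).1 u2.
set U := fine (\int[mu]_x (u x ^+ 2)%:E)%E.
have U0' : (0 <= \int[mu]_x (u x ^+ 2)%:E)%E.
  by apply: integral_ge0 => x _; rewrite lee_fin sqr_ge0.
have UE : (\int[mu]_x (u x ^+ 2)%:E = U%:E)%E by rewrite fineK// ge0_fin_numE.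
have U0 : 0 <= U by rewrite fine_ge0.
(* Chosen for [d U <= e / 2]; [U + 1] is nonzero also when [u] vanishes. *)
pose d := e / (2 * (U + 1)).
have d0 : 0 < d by rewrite divr_gt0// mulr_gt0// ltr_wpDl.
have dU : d * U <= e / 2.
  have U1 : 0 < 2 * (U + 1) by lra.
  by rewrite /d mulrAC ler_pdivrMr//; lra.
pose b x : R := if d < a x then a x else 0.
have mb : measurable_fun setT b.
  apply: (measurable_fun_ifT (f := fun x => d < a x) (g := a) (h := cst 0)) => //.
  exact: measurable_fun_ltr.
have b0 x : 0 <= b x by rewrite /b; case: ifPn => // h; rewrite ltW// (lt_trans d0).
have n1 : 1 <= n%:R / 2 :> R.
  by rewrite ler_pdivlMr// mul1r (ler_nat R 2 n).
have iab := Lfun_integrable n1 aL.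
have boo : (\int[mu]_x (b x)%:E < +oo)%E.
  apply: (@le_lt_trans _ _ (\int[mu]_x ((d `^ (1 - n%:R / 2))%:E * (`|a x| `^ (n%:R / 2))%:E))%E).
    apply: ge0_le_integral => //.
    - by move=> x _; rewrite lee_fin.
    - exact/measurable_EFinP.
    - by apply: measurable_funeM; exact: measurable_int iab.
    move=> x _; rewrite -EFinM lee_fin /b; case: ifPn => [ax|_]; last by rewrite mulr_ge0 ?powR_ge0.
    have a_gt0 : 0 < a x by rewrite (lt_trans d0).
    rewrite (gtr0_norm a_gt0).
    apply: (@le_trans _ _ (a x `^ (1 - n%:R / 2) * a x `^ (n%:R / 2))).
      by rewrite -powRD ?subrK ?powRr1 ?(ltW a_gt0)// oner_eq0.
    rewrite ler_wpM2r ?powR_ge0//.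
    have -> : 1 - n%:R / 2 = - (n%:R / 2 - 1) :> R by rewrite opprB.
    rewrite !powRN lef_pV2 ?posrE ?powR_gt0//.
    by apply: ge0_ler_powR; rewrite ?nnegrE ?subr_ge0// ltW.
  rewrite ge0_integralZl_EFin ?powR_ge0//; last exact: measurable_int iab.
  by rewrite lte_mul_pinfty ?lee_fin ?powR_ge0//; exact: (integrable_lty measurableT iab).
have e20 : 0 < e / 2 by rewrite divr_gt0.
have [y Hy] := exists_translate_Lfun1 (leq_trans (isT : 0 < 2)%N n2) e20 mb b0 boo u2.
exists y.
have muy : measurable_fun setT (fun x : E => u (x + y)).
  exact: (measurableT_comp mu_ (measurable_shift y)).
have mu2 : measurable_fun setT (fun x : E => u (x + y) ^+ 2).
  exact: (measurable_funX (f := fun x : E => u (x + y))).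
have mub : measurable_fun setT (fun x : E => b x * u (x + y) ^+ 2) by exact: measurable_funM.
have mud : measurable_fun setT (fun x : E => d * u (x + y) ^+ 2) by exact: measurable_funM.
apply: (@le_trans _ _ (\int[mu]_x ((d * u (x + y)%R ^+ 2)%:E + (b x * u (x + y)%R ^+ 2)%:E))%E).
  (* [a] may be negative on a null set, whereas monotonicity of the integral is applied to
     everywhere nonnegative functions. *)
  apply: (@le_trans _ _ (\int[mu]_x (Num.max 0 (a x) * u (x + y)%R ^+ 2)%:E)%E).
    rewrite le_eqVlt; apply/orP; left; apply/eqP; apply: ae_eq_integral => //.
    - by apply/measurable_EFinP; exact: measurable_funM.
    - apply/measurable_EFinP; apply: measurable_funM => //; exact: measurable_maxr.
    by apply: filterS a0 => x ax _; rewrite max_r.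
  apply: ge0_le_integral => //.
  - by move=> x _; rewrite lee_fin mulr_ge0 ?sqr_ge0// le_max lexx.
  - apply/measurable_EFinP; apply: measurable_funM => //; exact: measurable_maxr.
  - by apply: emeasurable_funD; exact/measurable_EFinP.
  move=> x _; rewrite -EFinD lee_fin -mulrDl ler_wpM2r ?sqr_ge0// /b.
  rewrite ge_max; case: ltP => h; apply/andP; split; lra.
rewrite ge0_integralD//; last 4 first.
- by move=> x _; rewrite lee_fin mulr_ge0 ?sqr_ge0// ltW.
- exact/measurable_EFinP.
- by move=> x _; rewrite lee_fin mulr_ge0 ?sqr_ge0.
- exact/measurable_EFinP.
have -> : e = e / 2 + e / 2 by lra.
rewrite EFinD; apply: leeD => //.
apply: (@le_trans _ _ (d * U)%:E); last by rewrite lee_fin.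
under eq_integral do rewrite EFinM.
rewrite ge0_integralZl_EFin ?(ltW d0)//; last 2 first.
- by move=> x _; rewrite lee_fin sqr_ge0.
- exact/measurable_EFinP.
rewrite (ge0_integral_shift y (f := fun x => (u x ^+ 2)%:E)).
- by rewrite UE.
- by apply/measurable_EFinP; exact: measurable_funX.
- by move=> z; rewrite lee_fin sqr_ge0.
Qed.

End translate.

(** * Integrals of functions that are nonnegative almost everywhere *)

Section ae_nonneg.
Context d (T : measurableType d) (R : realType) (mu : {measure set T -> \bar R}).

(** The coefficients have a sign only almost everywhere; passing to [max 0 f] reduces the rules of
    this section to functions nonnegative at every point. *)
Lemma ae_ge0_integral_max (f : T -> R) : measurable_fun setT f ->
  {ae mu, forall x, 0 <= f x} ->
  (\int[mu]_x (f x)%:E = \int[mu]_x (Num.max 0 (f x))%:E)%E.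
Proof.
move=> mf f0; apply: ae_eq_integral => //.
- exact/measurable_EFinP.
- by apply/measurable_EFinP; exact: measurable_maxr.
by apply: filterS f0 => x fx _; rewrite max_r.
Qed.

Lemma ae_ge0_integral_ge0 (f : T -> R) : measurable_fun setT f ->
  {ae mu, forall x, 0 <= f x} -> (0 <= \int[mu]_x (f x)%:E)%E.
Proof.
move=> mf f0; rewrite ae_ge0_integral_max//; apply: integral_ge0 => x _.
by rewrite lee_fin le_max lexx.
Qed.

Lemma ae_ge0_integralZl (f : T -> R) (c : R) : 0 <= c -> measurable_fun setT f ->
  {ae mu, forall x, 0 <= f x} ->
  (\int[mu]_x (c * f x)%:E = c%:E * \int[mu]_x (f x)%:E)%E.
Proof.
move=> c0 mf f0; rewrite (ae_ge0_integral_max mf f0).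
have mm : measurable_fun setT (fun x => Num.max 0 (f x)) by exact: measurable_maxr.
rewrite -ge0_integralZl_EFin//; last 2 first.
- by move=> x _; rewrite lee_fin le_max lexx.
- exact/measurable_EFinP.
apply: ae_eq_integral => //.
- by apply/measurable_EFinP; exact: measurable_funM.
- by apply: measurable_funeM; exact/measurable_EFinP.
by apply: filterS f0 => x fx _; rewrite max_r// EFinM.
Qed.

Lemma ae_ge0_integral_le (f g : T -> R) : measurable_fun setT f -> measurable_fun setT g ->
  {ae mu, forall x, 0 <= f x} -> {ae mu, forall x, f x <= g x} ->
  (\int[mu]_x (f x)%:E <= \int[mu]_x (g x)%:E)%E.
Proof.
move=> mf mg f0 fg.
have g0 : {ae mu, forall x, 0 <= g x}.
  by apply: filterS2 f0 fg => x; exact: le_trans.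
rewrite (ae_ge0_integral_max mf f0) (ae_ge0_integral_max mg g0).
apply: ae_ge0_le_integral => //.
- by move=> x _; rewrite lee_fin le_max lexx.
- by apply/measurable_EFinP; exact: measurable_maxr.
- by move=> x _; rewrite lee_fin le_max lexx.
- by apply/measurable_EFinP; exact: measurable_maxr.
apply: filterS fg => x fx _; rewrite lee_fin ge_max !le_max lexx/=.
by rewrite fx orbT.
Qed.

(** Covers infinite [x], where both sides are 0. Thus the scaling of [energy] can be computed before
    the quadratic part is known to be finite. *)
Lemma fineZ (c : R) (x : \bar R) : 0 < c -> fine (c%:E * x)%E = c * fine x.
Proof.
move=> c0; case: x => [r//||] /=.
- by rewrite gt0_muley ?lte_fin//= mulr0.
- by rewrite gt0_muleNy ?lte_fin//= mulr0.
Qed.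

Lemma ae_ge0_integral_eq0 (f : T -> R) : measurable_fun setT f ->
  {ae mu, forall x, 0 <= f x} -> (\int[mu]_x (f x)%:E = 0)%E ->
  {ae mu, forall x, f x = 0}.
Proof.
move=> mf f0; rewrite (ae_ge0_integral_max mf f0) => h.
have mm : measurable_fun setT (fun x => (Num.max 0 (f x))%:E).
  by apply/measurable_EFinP; exact: measurable_maxr.
have /(ae_eq_integral_abs _ measurableT mm) : (\int[mu]_x `|(Num.max 0 (f x))%:E| = 0)%E.
  by rewrite -[RHS]h; apply: eq_integral => x _; rewrite gee0_abs// lee_fin le_max lexx.
by apply: filterS2 f0 => x fx /(_ I) []; rewrite max_r.
Qed.

Lemma ae_ge0_integralD (f g : T -> R) : measurable_fun setT f -> measurable_fun setT g ->
  {ae mu, forall x, 0 <= f x} -> {ae mu, forall x, 0 <= g x} ->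
  (\int[mu]_x (f x + g x)%:E = \int[mu]_x (f x)%:E + \int[mu]_x (g x)%:E)%E.
Proof.
move=> mf mg f0 g0.
have mm (h : T -> R) : measurable_fun setT h -> measurable_fun setT (fun x => (Num.max 0 (h x))%:E).
  by move=> mh; apply/measurable_EFinP; exact: measurable_maxr.
rewrite (ae_ge0_integral_max mf f0) (ae_ge0_integral_max mg g0).
rewrite -ge0_integralD//; last 4 first.
- by move=> x _; rewrite lee_fin le_max lexx.
- exact: mm.
- by move=> x _; rewrite lee_fin le_max lexx.
- exact: mm.
apply: ae_eq_integral => //.
- by apply/measurable_EFinP; exact: measurable_funD.
- by apply: emeasurable_funD; exact: mm.
by apply: filterS2 f0 g0 => x fx gx _; rewrite !max_r// EFinD.
Qed.

Lemma Lfun_inf_ae_bounded (f : T -> R) : f \in Lfun mu +oo%E ->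
  exists2 M : R, 0 < M & {ae mu, forall x, f x <= M}.
Proof.
move=> /sub_Lfun_finLfun; rewrite inE /finite_norm unlock /=.
case: ifPn => [_ Soo|]; last first.
  (* A space of measure 0, which the definition of the L^oo norm treats apart; any bound holds
     almost everywhere there. *)
  rewrite -leNgt measure_le0 => /eqP T0 _; exists 1 => //.
  by exists setT; split.
have := ess_sup_ge mu (abse \o (EFin \o f)).
move: Soo; case: (ess_sup _ _) => [r _ h|//|_ h].
  exists (`|r| + 1); first by rewrite ltr_pwDr.
  apply: filterS h => x /=; rewrite lee_fin => h.
  by apply: (le_trans (ler_norm _)); apply: (le_trans h); rewrite ler_wpDr// ler_norm.
by exists 1 => //; apply: filterS h => x /=; rewrite leeNy_eq.
Qed.

End ae_nonneg.

(** * Energies with general coefficients and their Nehari sets *)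

Section energy_theory.
Context {R : realType} (n : nat).
Notation E := 'rV[R]_n.
Notation mu := (@lebesgue_rV R n).
Variables (p : R) (V Q : E -> R) (v0 q0 q1 : R).
Hypotheses (n2 : (2 <= n)%N) (p1 : 1 < p) (pn : (p + 1) * (n%:R - 2) < 2 * n%:R).
Hypotheses (mV : measurable_fun setT V) (mQ : measurable_fun setT Q).
Hypotheses (v0_gt0 : 0 < v0) (Vv0 : {ae mu, forall x, v0 <= V x}).
Hypotheses (q0_gt0 : 0 < q0) (Qq0 : {ae mu, forall x, q0 <= Q x}).
Hypotheses (q1_gt0 : 0 < q1) (Qq1 : {ae mu, forall x, Q x <= q1}).
Implicit Types u : E -> R.

(* Extended-real valued, so that finiteness can be discussed; [energy] applies
   [fine], which sends [+oo] to 0. *)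
Definition quad u : \bar R := (\int[mu]_x (grad2 u x + V x * u x ^+ 2)%:E)%E.
Definition pot u : \bar R := (\int[mu]_x (Q x * `|u x| `^ (p + 1))%:E)%E.

Let p1_gt0 : 0 < p + 1. Proof. by move: p1; lra. Qed.
Let p1_ge2 : 2 <= p + 1. Proof. by move: p1; lra. Qed.

Lemma energyE u : energy V Q p u = 2^-1 * fine (quad u) - (p + 1)^-1 * fine (pot u).
Proof. by []. Qed.

Lemma measurable_quad u : H1 u -> measurable_fun setT (fun x => grad2 u x + V x * u x ^+ 2).
Proof.
move=> uH; apply: measurable_funD; first exact: measurable_grad2.
by apply: measurable_funM => //; apply: measurable_funX; exact: H1_measurable.
Qed.

Lemma measurable_pot u : H1 u -> measurable_fun setT (fun x => Q x * `|u x| `^ (p + 1)).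
Proof.
by move=> uH; apply: measurable_funM => //; apply: measurable_Lpow; exact: H1_measurable.
Qed.

Lemma quad_ae_ge0 u : {ae mu, forall x, 0 <= grad2 u x + V x * u x ^+ 2}.
Proof.
apply: filterS Vv0 => x Vx; rewrite addr_ge0 ?grad2_ge0// mulr_ge0 ?sqr_ge0//.
by apply: le_trans Vx; exact: ltW.
Qed.

Lemma pot_ae_ge0 u : {ae mu, forall x, 0 <= Q x * `|u x| `^ (p + 1)}.
Proof.
apply: filterS Qq0 => x Qx; rewrite mulr_ge0 ?powR_ge0//.
by apply: le_trans Qx; exact: ltW.
Qed.

Lemma quadZ u c : 0 < c -> H1 u ->
  quad (fun x => c * u x) = ((c ^+ 2)%:E * quad u)%E.
Proof.
move=> c0 uH; rewrite /quad -ae_ge0_integralZl ?sqr_ge0//; last 2 first.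
- exact: measurable_quad.
- exact: quad_ae_ge0.
apply: ae_eq_integral => //.
- by apply/measurable_EFinP; exact: (measurable_quad (H1Z c uH)).
- by apply/measurable_EFinP; apply: measurable_funM => //; exact: measurable_quad.
apply: filterS (grad2Z c uH) => x -> _; congr (_%:E); ring.
Qed.

Lemma potZ u c : 0 < c -> H1 u ->
  pot (fun x => c * u x) = ((c `^ (p + 1))%:E * pot u)%E.
Proof.
move=> c0 uH; rewrite /pot -ae_ge0_integralZl ?powR_ge0//; last 2 first.
- exact: measurable_pot.
- exact: pot_ae_ge0.
apply: eq_integral => x _; rewrite normrM (gtr0_norm c0) powRM ?(ltW c0)//.
by congr (_%:E); ring.
Qed.

Lemma energyZ u c : 0 < c -> H1 u -> energy V Q p (fun x => c * u x) =
  2^-1 * (c ^+ 2 * fine (quad u)) - (p + 1)^-1 * (c `^ (p + 1) * fine (pot u)).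
Proof.
by move=> c0 uH; rewrite energyE quadZ// potZ// !fineZ ?powR_gt0// exprn_gt0.
Qed.

(** In the direction [u] itself the perturbation is [(1 + t) u], so by [energyZ] the energy is an
    explicit function of [t] wherever [1 + t > 0]. The identity also covers an infinite [quad u],
    which counts as 0 on both sides. *)
Lemma is_variation_energy u l : H1 u ->
  is_variation (energy V Q p) u u l <-> fine (quad u) - fine (pot u) = l.
Proof.
move=> uH; set A := fine _; set B := fine _.
pose f (t : R) := 2^-1 * ((1 + t) ^+ 2 * A) - (p + 1)^-1 * ((1 + t) `^ (p + 1) * B).
have df : is_derive (0 : R) (1 : R) f (A - B).
  have d1 : is_derive (0 : R) (1 : R) (fun t : R => 1 + t) 1.
    have := is_deriveD (is_derive_cst (1 : R) (0 : R) 1) (is_derive_id (0 : R) 1).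
    by rewrite add0r.
  have d2 : is_derive (1 : R) (1 : R) (@powR R ^~ (p + 1)) (p + 1).
    have i1 : (1 : R) \in `]0, +oo[ by rewrite in_itv/= ltr01.
    split; first exact: (@derivable_powR R 1 (p + 1) 1 i1).
    by rewrite -derive1E powR_derive1// powR1 mulr1.
  have d20 : is_derive (1 + 0 : R) (1 : R) (@powR R ^~ (p + 1)) (p + 1) by rewrite addr0.
  have d3 := is_derive1_comp d20 d1.
  have d4 := is_deriveX 2 d1.
  have d5 := is_deriveB (is_deriveM (is_derive_cst (2^-1 * A) (0 : R) (1 : R)) d4)
    (is_deriveM (is_derive_cst ((p + 1)^-1 * B) (0 : R) (1 : R)) d3).
  rewrite (_ : f = cst (2^-1 * A) * ((fun t : R => 1 + t) ^+ 2) -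
    cst ((p + 1)^-1 * B) * ((@powR R ^~ (p + 1)) \o (fun t : R => 1 + t))); last first.
    by apply/funext => t; rewrite /f /= !fctE; ring.
  apply: (is_derive_eq d5); rewrite /GRing.scale/= addr0 expr1.
  by have := p1_gt0; move/lt0r_neq0 => pn0; field.
have nf : \forall t \near (0 : R), f t = energy V Q p (fun x => u x + t * u x).
  near=> t.
  have t1 : 0 < 1 + t.
    have : - 1 < t by near: t; apply: lt_nbhsr; rewrite ltrN10.
    by rewrite -ltrBlDl sub0r.
  rewrite /f -energyZ//; congr (energy _ _ _ _); apply/funext => x; ring.
have de : is_derive (0 : R) (1 : R) (fun t => energy V Q p (fun x => u x + t * u x)) (A - B).
  exact: near_eq_is_derive df.
rewrite /is_variation; split=> [[_ dl]|<-//].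
by case: de => _; rewrite dl.
Unshelve. all: by end_near. Qed.

Definition level_cst : R := 2^-1 - (p + 1)^-1.

Lemma level_cst_gt0 : 0 < level_cst.
Proof. by rewrite subr_gt0 ltf_pV2 ?posrE//; move: p1; lra. Qed.

Lemma nehariP u : nehari (energy V Q p) u <->
  [/\ H1 u, ~ (u = cst 0 %[ae mu]) & fine (quad u) = fine (pot u)].
Proof.
split=> [[uH un0 /(is_variation_energy 0 uH) h]|[uH un0 h]]; split => //.
  by apply/eqP; rewrite -subr_eq0 h.
by apply/(is_variation_energy 0 uH); rewrite h subrr.
Qed.

Lemma nehari_energy u : nehari (energy V Q p) u ->
  energy V Q p u = level_cst * fine (quad u).
Proof. by move=> /nehariP[uH un0 h]; rewrite energyE -h /level_cst mulrBl. Qed.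

Lemma pot_le_Lpow u : H1 u -> (pot u <= q1%:E * Lpow (p + 1) u)%E.
Proof.
move=> uH; have mL : measurable_fun setT (fun x => `|u x| `^ (p + 1)).
  by apply: measurable_Lpow; exact: H1_measurable.
rewrite -ge0_integralZl_EFin ?(ltW q1_gt0)//; last exact/measurable_EFinP.
apply: (ae_ge0_integral_le (measurable_pot uH)).
- by apply: measurable_funM => //; exact: measurable_cst.
- exact: pot_ae_ge0.
by apply: filterS Qq1 => x h; rewrite ler_wpM2r ?powR_ge0.
Qed.

Lemma pot_ge0 u : H1 u -> (0 <= pot u)%E.
Proof. by move=> uH; apply: ae_ge0_integral_ge0; [exact: measurable_pot|exact: pot_ae_ge0]. Qed.

Lemma quad_ge0 u : H1 u -> (0 <= quad u)%E.
Proof. by move=> uH; apply: ae_ge0_integral_ge0; [exact: measurable_quad|exact: quad_ae_ge0]. Qed.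

Lemma pot_fin u : H1 u -> pot u \is a fin_num.
Proof.
move=> uH; rewrite ge0_fin_numE; last exact: pot_ge0.
apply: le_lt_trans (pot_le_Lpow uH) _.
by rewrite lte_mul_pinfty ?lee_fin ?(ltW q1_gt0)//; exact: Lpow_fin.
Qed.

Lemma pot_gt0 u : H1 u -> ~ (u = cst 0 %[ae mu]) -> 0 < fine (pot u).
Proof.
move=> uH un0; rewrite lt_def fine_ge0 ?pot_ge0// andbT; apply/eqP => h0; apply: un0.
have : pot u = 0%E by rewrite -(fineK (pot_fin uH)) h0.
move/(ae_ge0_integral_eq0 (measurable_pot uH) (pot_ae_ge0 u)).
apply: filterS2 Qq0 => x Qx /eqP; rewrite mulf_eq0 => /orP[/eqP Q0|h] _.
  by move: Qx; rewrite Q0 leNgt q0_gt0.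
by move: h; rewrite powR_eq0 normr_eq0 => /andP[/eqP].
Qed.

(** The 1 serves the gradient term, and [v0^-1] the term of order zero, where [V >= v0]. *)
Let kappa : R := Num.max 1 v0^-1.

Let kappa_gt0 : 0 < kappa. Proof. by rewrite lt_max ltr01. Qed.

Lemma H1_energy_le_quad u : H1 u -> (H1_energy u <= kappa%:E * quad u)%E.
Proof.
move=> uH; rewrite /quad -ae_ge0_integralZl ?(ltW kappa_gt0)//; last 2 first.
- exact: measurable_quad.
- exact: quad_ae_ge0.
apply: ae_ge0_integral_le.
- exact: measurable_H1_energy.
- by apply: measurable_funM => //; exact: measurable_quad.
- by apply: aeW => x; rewrite addr_ge0 ?grad2_ge0 ?sqr_ge0.
apply: filterS Vv0 => x Vx; rewrite mulrDr mulrA.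
have k1 : 1 <= kappa by rewrite le_max lexx.
apply: lerD; first by rewrite ler_peMl ?grad2_ge0.
rewrite ler_peMl ?sqr_ge0//.
have kv : 1 <= kappa * v0 by rewrite -ler_pdivrMr// div1r le_max lexx orbT.
by apply: (le_trans kv); rewrite ler_wpM2l// ltW.
Qed.

Lemma quad_gt0 u : H1 u -> ~ (u = cst 0 %[ae mu]) -> quad u \is a fin_num ->
  0 < fine (quad u).
Proof.
move=> uH un0 qf; rewrite lt_def fine_ge0 ?quad_ge0// andbT; apply/eqP => h0; apply: un0.
have q0' : quad u = 0%E by rewrite -(fineK qf) h0.
have := le_trans (sqr_le_H1_energy uH) (H1_energy_le_quad uH).
rewrite q0' mule0 => u0.
have : (\int[mu]_x (u x ^+ 2)%:E = 0)%E.
  apply/eqP; rewrite eq_le u0 /=; apply: integral_ge0 => x _; by rewrite lee_fin sqr_ge0.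
move/ae_ge0_integral_eq0 => H.
have : {ae mu, forall x, u x ^+ 2 = 0}.
  apply: H; first by apply: measurable_funX; exact: H1_measurable.
  by apply: aeW => x; exact: sqr_ge0.
by apply: filterS => x /eqP; rewrite sqrf_eq0 => /eqP.
Qed.

Lemma nehari_quad_lb : exists2 c : R, 0 < c &
  forall u, nehari (energy V Q p) u -> c <= fine (quad u).
Proof.
have [C C0 HC] := sobolev_subcritical n2 p1_ge2 pn.
(* With [m^2 = kappa A], dividing [A <= q1 C m^(p+1)] by [A] gives [z <= m^(p-1)], that is, a lower
   bound for [m] and hence for [A]. *)
pose z := (kappa * q1 * C)^-1.
have z0 : 0 < z by rewrite invr_gt0 !mulr_gt0.
have pm1 : 0 < p - 1 by rewrite subr_gt0.
exists ((z `^ (p - 1)^-1) ^+ 2 / kappa).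
  by rewrite divr_gt0// exprn_gt0// powR_gt0.
move=> u /nehariP[uH un0 AB].
have B0 := pot_gt0 uH un0; set A := fine (quad u).
have A0 : 0 < A by rewrite /A AB.
(* If [quad u] were infinite, [A] would be 0, whereas [A] equals [fine (pot u)]. *)
have qE : quad u = A%:E.
  rewrite fineK// ge0_fin_numE ?quad_ge0//.
  by rewrite ltNge leye_eq; apply/negP => /eqP h; move: A0; rewrite /A h ltxx.
pose m := Num.sqrt (kappa * A).
have kA0 : 0 < kappa * A by rewrite mulr_gt0.
have m0 : 0 < m by rewrite sqrtr_gt0.
have m2 : m ^+ 2 = kappa * A by rewrite sqr_sqrtr// ltW.
have := H1_energy_le_quad uH; rewrite qE -EFinM -m2 => /(HC _ _ uH m0) HL.
have : (pot u <= q1%:E * (C * m `^ (p + 1))%:E)%E.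
  apply: le_trans (pot_le_Lpow uH) _; apply: lee_wpmul2l => //.
  by rewrite lee_fin ltW.
rewrite -(fineK (pot_fin uH)) -AB -/A -EFinM lee_fin => HA.
have mpE : m `^ (p + 1) = m `^ (p - 1) * (kappa * A).
  rewrite -m2 -(powR_mulrn _ (ltW m0)) -powRD; last by rewrite (gt_eqF m0) implybT.
  by congr (_ `^ _); lra.
have zm : z <= m `^ (p - 1).
  rewrite /z -[_^-1]mul1r ler_pdivrMr ?mulr_gt0//.
  rewrite -(ler_pM2r A0) mul1r; apply: le_trans HA _; rewrite mpE.
  by rewrite le_eqVlt; apply/orP; left; apply/eqP; ring.
have zm' : z `^ (p - 1)^-1 <= m.
  have -> : m = (m `^ (p - 1)) `^ (p - 1)^-1.
    by rewrite -powRrM mulfV ?gt_eqF// powRr1// ltW.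
  apply: ge0_ler_powR => //; rewrite ?nnegrE ?powR_ge0//; last exact: (ltW z0).
  by rewrite invr_ge0 ltW.
rewrite ler_pdivrMr// mulrC -m2.
by apply: lerXn2r; rewrite ?nnegrE ?powR_ge0 ?(ltW m0).
Qed.

Lemma nehari_projection u : H1 u -> ~ (u = cst 0 %[ae mu]) -> quad u \is a fin_num ->
  exists2 w, nehari (energy V Q p) w &
  energy V Q p w = level_cst * ((fine (quad u) / fine (pot u)) `^ (2 / (p - 1)) * fine (quad u)).
Proof.
move=> uH un0 qf; have A0 := quad_gt0 uH un0 qf; have B0 := pot_gt0 uH un0.
set A := fine (quad u) in A0 *; set B := fine (pot u) in B0 *.
have pm1 : 0 < p - 1 by rewrite subr_gt0.
have AB0 : 0 < A / B by rewrite divr_gt0.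
(* The positive solution of [t^2 A = t^(p+1) B], which puts [t u] in the Nehari set. *)
pose t := (A / B) `^ (p - 1)^-1.
have t0 : 0 < t by rewrite powR_gt0.
have t2 : t ^+ 2 = (A / B) `^ (2 / (p - 1)).
  by rewrite -(powR_mulrn _ (ltW t0)) /t -powRrM [_^-1 * 2]mulrC.
have tp : t `^ (p + 1) * B = t ^+ 2 * A.
  rewrite -(powR_mulrn _ (ltW t0)).
  have -> : p + 1 = 2 + (p - 1) by lra.
  rewrite powRD; last by rewrite (gt_eqF t0) implybT.
  rewrite -mulrA; congr (_ * _).
  by rewrite /t -powRrM mulVf ?gt_eqF// powRr1 ?(ltW AB0)// mulfVK// gt_eqF.
have wN : nehari (energy V Q p) (fun x => t * u x).
  apply/nehariP; split; first exact: H1Z.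
    move=> h; apply: un0; apply: filterS h => x h Tx; have := h Tx => /= /eqP.
    by rewrite mulf_eq0 gt_eqF//= => /eqP.
  by rewrite quadZ// potZ// !fineZ ?exprn_gt0 ?powR_gt0// tp.
exists (fun x => t * u x) => //.
by rewrite nehari_energy// quadZ// fineZ ?exprn_gt0// t2.
Qed.

End energy_theory.

(** * Comparison of the two levels *)

Section comparison.
Context {R : realType} (n : nat).
Notation E := 'rV[R]_n.
Notation mu := (@lebesgue_rV R n).
Implicit Types u : E -> R.

(** Provides, after projection, an element of the Nehari set. The bump is positive on the unit cube,
    whose measure is 1. *)
Lemma H1_nonzero : exists2 u : E -> R, H1 u & ~ (u = cst 0 %[ae mu]).
Proof.
exists (obump 1 (const_mx 0) (const_mx 1)).
  by apply: H1_test; exact: test_function_obump.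
move=> [N [mN N0 sub]].
have : obox (const_mx 0) (const_mx 1) `<=` N.
  move=> x xo; apply: sub => /= /(_ I).
  by apply/eqP; rewrite gt_eqF// obump_gt0.
move=> /(subset_measure0 (measurable_obox _ _) mN) /(_ N0) h0.
have : lebesgue_rV n (obox (const_mx 0) (const_mx 1) : set E) = 1%E.
  rewrite lebesgue_rV_obox => [|i]; last by rewrite !mxE.
  by rewrite big1// => i _; rewrite !mxE subr0.
by rewrite h0 => -[] /eqP; rewrite eq_sym oner_eq0.
Qed.

Lemma quad_cst_fin (c : R) u : 0 < c -> H1 u -> quad (cst c) u \is a fin_num.
Proof.
move=> c0 uH.
have mq : measurable_fun setT (fun x => grad2 u x + cst c x * u x ^+ 2).
  apply: measurable_funD; first exact: measurable_grad2.
  by apply: measurable_funM => //; apply: measurable_funX; exact: H1_measurable.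
have q0 x : (0 <= (grad2 u x + cst c x * u x ^+ 2)%:E)%E.
  by rewrite lee_fin addr_ge0 ?grad2_ge0// mulr_ge0 ?sqr_ge0// ltW.
rewrite ge0_fin_numE; last by apply: integral_ge0 => x _; exact: q0.
pose k := Num.max 1 c.
have k1 : 1 <= k by rewrite le_max lexx.
have kc : c <= k by rewrite le_max lexx orbT.
apply: (@le_lt_trans _ _ (\int[mu]_x (k%:E * (grad2 u x + u x ^+ 2)%:E))%E).
  apply: ge0_le_integral => //.
  - exact/measurable_EFinP.
  - by apply: measurable_funeM; apply/measurable_EFinP; exact: measurable_H1_energy.
  move=> x _; rewrite -EFinM lee_fin mulrDr lerD ?ler_wpM2r ?sqr_ge0//.
  by rewrite ler_peMl ?grad2_ge0.
rewrite ge0_integralZl_EFin//; last 3 first.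
- by move=> x _; rewrite lee_fin addr_ge0 ?grad2_ge0 ?sqr_ge0.
- by apply/measurable_EFinP; exact: measurable_H1_energy.
- exact: le_trans k1.
rewrite lte_mul_pinfty ?lee_fin ?(le_trans ler01 k1)//.
exact: H1_energy_fin.
Qed.

Lemma quad_cst_translate (c : R) u y : H1 u ->
  quad (cst c) (fun x => u (x + y)) = quad (cst c) u.
Proof.
move=> uH; have mu_ := H1_measurable uH.
have mq (v : E -> R) : H1 v -> measurable_fun setT (fun x => (grad2 v x + cst c x * v x ^+ 2)%:E).
  move=> vH; apply/measurable_EFinP; apply: measurable_funD; first exact: measurable_grad2.
  by apply: measurable_funM => //; apply: measurable_funX; exact: H1_measurable.
rewrite /quad -[RHS](integral_shift y (mq _ uH)).
apply: ae_eq_integral => //.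
- exact: (mq _ (H1_translate y uH)).
- exact: (measurableT_comp (mq _ uH) (measurable_shift y)).
by apply: filterS (grad2_translate y uH) => x ->.
Qed.

Lemma pot_cst_translate (p c : R) u y : measurable_fun setT u ->
  pot p (cst c) (fun x => u (x + y)) = pot p (cst c) u.
Proof.
move=> mu_; rewrite /pot.
apply: (integral_shift y (f := fun x => (cst c x * `|u x| `^ (p + 1))%:E)).
by apply/measurable_EFinP; apply: measurable_funM => //; exact: measurable_Lpow.
Qed.

End comparison.

Theorem proposition2p3 (R : realType) (N : nat) (p ainf binf lambda : R)
    (a b : 'rV[R]_N -> R)
    (hN : (2 <= N)%N)
    (hp1 : 1 < p)
    (hp : (3 <= N)%N -> p < (N%:R + 2) / (N%:R - 2))
    (hainf : 0 < ainf) (hbinf : 0 < binf)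
    (ha : a \in Lfun (@lebesgue_rV R N) (N%:R / 2)%:E)
    (ha_ge0 : {ae @lebesgue_rV R N, forall x, 0 <= a x})
    (ha_neq0 : ~ (a = cst 0 %[ae @lebesgue_rV R N]))
    (ha_lim : ae_lim_infty a 0)
    (hb : b \in Lfun (@lebesgue_rV R N) +oo%E)
    (hb_ge0 : {ae @lebesgue_rV R N, forall x, 0 <= b x})
    (hb_neq0 : ~ (b = cst 0 %[ae @lebesgue_rV R N]))
    (hb_lim : ae_lim_infty b 0)
    (hlambda : 0 <= lambda) :
  0 < nehari_level (I_lambda ainf binf p lambda a b)
    <= nehari_level (@I_infty R N ainf binf p).
Proof.
(* Subcriticality without a denominator: for [N >= 3] it is the bound on [p] multiplied out, and for
   [N = 2] the left-hand side is 0. *)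
have pn : (p + 1) * (N%:R - 2) < 2 * N%:R.
  have [N3|N3] := leqP 3 N.
    have n3 : 3 <= N%:R :> R by rewrite (ler_nat R 3 N).
    have n0 : 0 < N%:R - 2 :> R by lra.
    by have := hp N3; rewrite ltr_pdivlMr//; lra.
  have -> : N = 2%N by apply/eqP; rewrite eqn_leq hN -ltnS N3.
  by rewrite subrr mulr0; lra.
have ma := Lfun_measurable ha; have mb := Lfun_measurable hb.
have [M M0 HM] := Lfun_inf_ae_bounded hb.
pose V x := ainf + lambda * a x; pose Q x := binf + b x.
have mV : measurable_fun setT V.
  by apply: measurable_funD => //; exact: measurable_funM.
have mQ : measurable_fun setT Q by exact: measurable_funD.
have Vge : {ae @lebesgue_rV R N, forall x, ainf <= V x}.
  by apply: filterS ha_ge0 => x ax; rewrite lerDl mulr_ge0.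
have Qge : {ae @lebesgue_rV R N, forall x, binf <= Q x}.
  by apply: filterS hb_ge0 => x bx; rewrite lerDl.
have QM0 : 0 < binf + M by rewrite addr_gt0.
have Qle : {ae @lebesgue_rV R N, forall x, Q x <= binf + M}.
  by apply: filterS HM => x bx; rewrite lerD2l.
have mVi : measurable_fun setT (cst ainf : 'rV[R]_N -> R) by [].
have mQi : measurable_fun setT (cst binf : 'rV[R]_N -> R) by [].
have Vi : {ae @lebesgue_rV R N, forall x, ainf <= cst ainf x} by apply: aeW => x /=.
have Qi : {ae @lebesgue_rV R N, forall x, binf <= cst binf x} by apply: aeW => x /=.
have Qi' : {ae @lebesgue_rV R N, forall x, cst binf x <= binf} by apply: aeW => x /=.
pose kap := level_cst p.
have kap0 : 0 < kap by exact: level_cst_gt0.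
pose g := 2 / (p - 1).
have g0 : 0 < g by rewrite divr_gt0// subr_gt0.
set Fl := I_lambda _ _ _ _ _ _; set Fi := I_infty _ _ _.
(* The projected level is [(A / B)^g A] up to the factor [kap]. The translate has [A_lambda <= s A]
   and [B_lambda >= A], so the ratio contributes [s^g] and the last factor contributes [s]. *)
have cmp u s : nehari Fi u -> 1 < s -> exists2 w, nehari Fl w & Fl w <= Fi u * (s `^ g * s).
  move=> uN s1; have s0 : 0 < s by rewrite (lt_trans ltr01).
  have -> : Fi u = kap * fine (quad (cst ainf) u) by exact: (nehari_energy hp1 mVi mQi hainf Vi hbinf Qi uN).
  have := uN => /(nehariP hp1 mVi mQi hainf Vi hbinf Qi u) [uH un0 AB].
  have u2 := H1_Lfun2 uH; have mu_ := H1_measurable uH.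
  have A0 := pot_gt0 hN hp1 pn mQi hbinf Qi hbinf Qi' uH un0.
  have qif := quad_cst_fin hainf uH.
  have pif := pot_fin hN hp1 pn mQi hbinf Qi hbinf Qi' uH.
  rewrite -{1}AB in A0; set A := fine (quad (cst ainf) u) in A0 AB *.
  have l1 : 0 < lambda + 1 by rewrite ltr_wpDl.
  (* The tolerance for the integral of [a v^2]: multiplied by [lambda] it is at most [A (s - 1)].
     Dividing by [lambda + 1] covers [lambda = 0]. *)
  have e0 : 0 < A * (s - 1) / (lambda + 1) by rewrite divr_gt0// mulr_gt0// subr_gt0.
  have [y yle] := exists_translate hN e0 ha ha_ge0 u2.
  pose v x := u (x + y).
  have vH : H1 v by exact: H1_translate.
  have mv := H1_measurable vH.
  have pv : pot p (cst binf) v = A%:E by rewrite pot_cst_translate// AB fineK.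
  have qv : quad (cst ainf) v = A%:E by rewrite quad_cst_translate// fineK.
  have vn0 : ~ (v = cst 0 %[ae @lebesgue_rV R N]).
    move=> v0; suff p0 : pot p (cst binf) v = 0%E by move: pv A0; rewrite p0 => -[<-]; rewrite ltxx.
    rewrite /pot -[RHS](integral0 (@lebesgue_rV R N) setT); apply: ae_eq_integral => //.
      by apply/measurable_EFinP; exact: measurable_pot.
    apply: filterS v0 => x vx _; rewrite vx//= normr0 powR0 ?mulr0//.
    by rewrite gt_eqF// addr_gt0// (lt_trans ltr01).
  have av0 : {ae @lebesgue_rV R N, forall x, 0 <= a x * v x ^+ 2}.
    by apply: filterS ha_ge0 => x ax; apply: mulr_ge0 => //; exact: sqr_ge0.
  have mav : measurable_fun setT (fun x => a x * v x ^+ 2).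
    by apply: measurable_funM => //; exact: measurable_funX.
  have qVE : quad V v = (A%:E + lambda%:E * \int[@lebesgue_rV R N]_x (a x * v x ^+ 2)%:E)%E.
    rewrite -qv -ae_ge0_integralZl// -ae_ge0_integralD//.
    - apply: eq_integral => x _; congr (_%:E); rewrite /V /=; ring.
    - exact: measurable_quad.
    - exact: measurable_funM.
    - exact: (quad_ae_ge0 hainf Vi).
    - by apply: filterS av0 => x h; exact: mulr_ge0.
  have qVle : (quad V v <= (s * A)%:E)%E.
    rewrite qVE; apply: (@le_trans _ _ (A%:E + lambda%:E * (A * (s - 1) / (lambda + 1))%:E)%E).
      by rewrite leeD2l// lee_wpmul2l.
    rewrite -EFinM -EFinD lee_fin.
    suff : lambda * (A * (s - 1) / (lambda + 1)) <= A * (s - 1) by lra.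
    rewrite mulrCA ler_piMr//; first by rewrite ltW// mulr_gt0// subr_gt0.
    by rewrite ler_pdivrMr// mul1r lerDl.
  have qV0 := quad_ge0 mV hainf Vge vH.
  have qVf : quad V v \is a fin_num.
    by rewrite ge0_fin_numE//; apply: le_lt_trans qVle _; rewrite ltry.
  have pQf := pot_fin hN hp1 pn mQ hbinf Qge QM0 Qle vH.
  have pQle : A <= fine (pot p Q v).
    rewrite -lee_fin (fineK pQf) -pv; apply: ae_ge0_integral_le.
    - exact: measurable_pot.
    - exact: measurable_pot.
    - exact: (pot_ae_ge0 _ hbinf Qi).
    - by apply: filterS Qge => x h; rewrite ler_wpM2r ?powR_ge0.
  have [w wN wE] := nehari_projection hN hp1 pn mV mQ hainf Vge hbinf Qge QM0 Qle vH vn0 qVf.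
  exists w => //; rewrite [Fl w]wE -/g -/kap -mulrA ler_wpM2l ?(ltW kap0)//.
  have qVle' : fine (quad V v) <= s * A by rewrite -lee_fin fineK.
  have qV0' : 0 <= fine (quad V v) by exact: fine_ge0.
  have B0 : 0 < fine (pot p Q v) by exact: lt_le_trans pQle.
  rewrite [leRHS]mulrC -mulrA; apply: ler_pM => //; first exact: powR_ge0.
  apply: ge0_ler_powR; rewrite ?nnegrE ?(ltW g0) ?(ltW s0) ?divr_ge0 ?(ltW B0)//.
  by rewrite ler_pdivrMr//; apply: (le_trans qVle'); rewrite ler_wpM2l// ltW.
(* Bounding either infimum from below requires its set to be inhabited; comparison with [s = 2]
   transfers an element to the Nehari set of [Fl]. *)
have [u0 u0N] : exists u, nehari Fi u.
  have [u uH un0] := @H1_nonzero R N.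
  by have [w wN _] := nehari_projection hN hp1 pn mVi mQi hainf Vi hbinf Qi hbinf Qi'
    uH un0 (quad_cst_fin hainf uH); exists w.
have [w0 w0N _] : exists2 w, nehari Fl w & Fl w <= Fi u0 * (2 `^ g * 2).
  by apply: cmp => //; rewrite ltr1n.
have [c c0 cle] := nehari_quad_lb hN hp1 pn mV mQ hainf Vge hbinf Qge QM0 Qle.
have lbl : lbound [set Fl u | u in nehari Fl] (kap * c).
  move=> _ [w wN <-]; have -> : Fl w = kap * fine (quad V w) by exact: (nehari_energy hp1 mV mQ hainf Vge hbinf Qge wN).
  by rewrite ler_wpM2l ?(ltW kap0)//; exact: cle.
have ml0 : 0 < nehari_level Fl.
  apply: (@lt_le_trans _ _ (kap * c)); first exact: mulr_gt0.
  by apply: lb_le_inf => //; exists (Fl w0), w0.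
rewrite ml0 /=; apply: lb_le_inf; first by exists (Fi u0), u0.
move=> _ [u uN <-]; rewrite leNgt; apply/negP => lt_mu.
have mle s : 1 < s -> nehari_level Fl <= Fi u * (s `^ g * s).
  move=> s1; have [w wN wle] := cmp u s uN s1; apply: le_trans wle.
  by apply: ge_inf; [exists (kap * c)|exists w].
have K0 : 0 < Fi u.
  have := lt_le_trans ml0 (mle 2 _); rewrite ltr1n => /(_ isT).
  by rewrite pmulr_lgt0// mulr_gt0// powR_gt0.
(* If the level exceeded [Fi u], then [r > 1]. Choosing [s] with [s^(g+1) = sqrt r] in [mle] gives
   [r <= sqrt r], a contradiction. *)
pose r := nehari_level Fl / Fi u.
have r1 : 1 < r by rewrite ltr_pdivlMr// mul1r.
have r0 : 0 < r by exact: lt_trans r1.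
have g1 : 0 < g + 1 by rewrite addr_gt0.
pose s := (Num.sqrt r) `^ (g + 1)^-1.
have q1 : 1 < Num.sqrt r by rewrite -sqrtr1 ltr_sqrt.
have q0 : 0 < Num.sqrt r by exact: lt_trans q1.
have s1 : 1 < s.
  have {1}-> : 1 = 1 `^ (g + 1)^-1 :> R by rewrite powR1.
  apply: gt0_ltr_powR; rewrite ?invr_gt0 ?nnegrE ?ler01 ?(ltW q0)//.
have s0 : 0 < s by exact: lt_trans s1.
have sE : s `^ g * s = Num.sqrt r.
  rewrite -{2}(powRr1 (ltW s0)) -powRD; last by rewrite (gt_eqF s0) implybT.
  by rewrite /s -powRrM mulVf ?gt_eqF// powRr1// ltW.
have := mle s s1; rewrite sE mulrC -ler_pdivrMr// -/r leNgt.
by rewrite -{2}(sqr_sqrtr (ltW r0)) expr2 ltr_pMr// q1.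
Qed.
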